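(* In a triangulated structure with prescribed edge lengths $\ell_{ij}$ satisfying the strict triangle inequality on every triangle and satisfying the compatibility conditions (the angles at each interior vertex add up to $2\pi$), suppose that $\mathcal P$ is a union of closed stars of interior vertices that is bounded by a single simple closed curve $\gamma$. Then the total turning angle of $\gamma$ may be expressed in terms of the prescribed lengths of edges on or within one link of the boundary: $$2\pi=\sum_{V_i\in\gamma}\left[\pi-\sum_{\triangle(V_j,V_i,V_k)\in\mathcal F}\alpha(V_j,V_i,V_k)\right],$$ where $\mathcal F$ is the set of triangular faces of $\mathcal P$ (the inner sum being over the faces having $V_i$ as a vertex) and $$\alpha(V_j,V_i,V_k)=\cos^{-1}\left(\frac{\ell_{ij}^2+\ell_{ik}^2-\ell_{jk}^2}{2\,\ell_{ij}\,\ell_{ik}}\right)$$ is the angle of the triangle at $V_i$.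
   Context: A triangulated structure consists of the vertices and edges of a piecewise linear triangulation (finitely many closed triangles meeting only in a common vertex or along a whole common edge) of a planar domain. Each edge $V_iV_j$ carries a prescribed positive length $\ell_{ij}$. The closed star of a vertex is the union of the closed triangles containing it. The compatibility condition at an interior vertex $V_i$ is that the sum over the triangles containing $V_i$ of their angles at $V_i$, computed from the lengths by the cosine law, equals $2\pi$. *)

(* Defs.v *)
(* Vertices are labelled by a finite type V and placed in the plane by pos; a
   triangle is a 3-element {set V} and T : {set {set V}} is the finite set of
   triangles.  The prescribed lengths l : V -> V -> R are unrelated to the
   distances between the points pos v. *)
From HB Require Import structures.
From mathcomp Require Export all_boot all_order all_algebra.
From mathcomp Require Export all_classical all_reals all_analysis.

Set Implicit Arguments.
Unset Strict Implicit.
Unset Printing Implicit Defensive.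

Import Order.TTheory GRing.Theory Num.Theory.
Import numFieldNormedType.Exports.
Local Open Scope classical_set_scope.
Local Open Scope ring_scope.

Section Triangulations.
Variables (R : realType) (V : finType).
Implicit Types (pos : V -> 'rV[R]_2) (T F : {set {set V}}) (l : V -> V -> R).
Implicit Types (P gamma : set 'rV[R]_2).

Definition hull pos (s : {set V}) : set 'rV[R]_2 :=
  [set x | exists w : V -> R, [/\ forall v, v \in s -> 0 <= w v,
     \sum_(v in s) w v = 1 & x = \sum_(v in s) w v *: pos v]].

Definition affinely_independent pos (s : {set V}) : Prop :=
  forall w : V -> R, \sum_(v in s) w v = 0 ->
    \sum_(v in s) w v *: pos v = 0 -> forall v, v \in s -> w v = 0.

Definition carrier pos T : set 'rV[R]_2 := \bigcup_(t in [set` T]) hull pos t.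

Definition edge T (u v : V) : Prop :=
  u != v /\ exists2 t, t \in T & (u \in t) && (v \in t).

(* Of the triangulated planar domain only connectedness is retained: the
   carrier, a finite union of nondegenerate triangles, is in any case compact
   and the closure of its interior. *)
Record triangulation pos T : Prop := Triangulation {
  triangulation_pos_inj : injective pos ;
  triangulation_cover : forall v, exists2 t, t \in T & v \in t ;
  triangulation_card : forall t, t \in T -> #|t| = 3%N ;
  triangulation_nondegenerate :
    forall t, t \in T -> affinely_independent pos t ;
  triangulation_meet : forall t t', t \in T -> t' \in T -> t != t' ->
    [\/ hull pos t `&` hull pos t' = set0,
        exists v, [/\ v \in t, v \in t' &
          hull pos t `&` hull pos t' = [set pos v]] |
        exists u v, [/\ u != v, (u \in t) && (v \in t),
          (u \in t') && (v \in t') &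
          hull pos t `&` hull pos t' = hull pos [set u; v]%SET]] ;
  triangulation_connected : connected (carrier pos T) }.

Definition interior_vertex pos T (v : V) : Prop :=
  interior (carrier pos T) (pos v).

Definition closed_star pos T (v : V) : set 'rV[R]_2 :=
  \bigcup_(t in [set t | (t \in T) && (v \in t)]) hull pos t.

Definition edge_lengths T l : Prop :=
  forall u v, edge T u v -> l u v = l v u /\ 0 < l u v.

(* i, j, k range over all orderings of the vertices of a triangle, so each of
   the three inequalities is covered. *)
Definition strict_triangle_inequality T l : Prop :=
  forall i j k, [set i; j; k]%SET \in T -> l i k < l i j + l j k.

Definition angle l (j i k : V) : R :=
  acos ((l i j ^+ 2 + l i k ^+ 2 - l j k ^+ 2) / (2 * l i j * l i k)).

(* The comparison of ranks makes every face {j, i, k} count exactly once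
   rather than once for (j, k) and once for (k, j). *)
Definition angle_sum l F (i : V) : R :=
  \sum_j \sum_(k | (enum_rank j < enum_rank k)%N &&
                   ([set j; i; k]%SET \in F)) angle l j i k.

Definition compatible pos T l : Prop :=
  forall i, interior_vertex pos T i -> angle_sum l T i = 2 * pi.

Definition union_of_interior_stars pos T P : Prop :=
  exists2 S : {set V}, (forall v, v \in S -> interior_vertex pos T v) &
    P = \bigcup_(v in [set` S]) closed_star pos T v.

Definition faces pos T P : {set {set V}} :=
  [set t in T | `[< hull pos t `<=` P >]]%SET.

Definition simple_closed_curve gamma : Prop :=
  exists c : R -> 'rV[R]_2,
    [/\ {within `[0, 1], continuous c}, c 0 = c 1,
        {in `[0, 1[ &, injective c} & gamma = c @` `[0, 1]].

(* gamma is the whole topological boundary of P; when gamma is a simple closed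
   curve, P therefore has neither holes nor pinch points. *)
Definition bounded_by P gamma : Prop := closure P `\` interior P = gamma.

End Triangulations.

(* Main.v *)
(* All angles of the faces add up to pi times their number F, and the angles at
   an interior vertex to 2 pi, so everything reduces to V - E + F = 1 together
   with the fact that gamma has as many edges as vertices.  The Euler relation
   is proved with F_2 coefficients, as exactness of the cellular chain complex
   of P:
   - a nonempty set of triangles has an edge on just one of them, since
     otherwise its carrier would be a neighbourhood of its rightmost vertex;
   - an even set z of edges is a boundary: the parity of the number of crossings
     of a vertical ray with z is constant on the faces and changes across the
     edges of z, and on the outer sides of the edges of gamma it is constant
     because gamma is a single cycle, so that after adding a constant it bounds z;
   - a function on the vertices that is constant on edges is constant, because
     every component of P has boundary edges and gamma is connected.
   That gamma is a single cycle follows from its parametrization: a closed curve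
   passing once through n >= 1 vertices has at most n edges, while an even graph
   without isolated vertices has at least as many edges as vertices, with
   equality only if all degrees are 2. *)
Require Import Defs.
From mathcomp Require Import zify ring lra.

Set Implicit Arguments.
Unset Strict Implicit.
Unset Printing Implicit Defensive.

Import Order.TTheory GRing.Theory Num.Theory.
Import numFieldNormedType.Exports.
Local Open Scope ring_scope.

(** * The Euler relation from exactness over F_2 *)

(** The hypotheses on [gamma] are topological while the count is combinatorial; the bridge is that
    the frontier of a union of faces is carried by the edges lying on exactly one of them.
    Coefficients in F_2 avoid orienting edges and faces, and the parity of ray crossings is then
    directly a function on faces. For the final count let v, e, f be the numbers of vertices, edges
    and faces of [P], and w the number of vertices on [gamma]. The angles at boundary vertices add
    up to pi f - 2 pi (v - w), so the right-hand side is 2 pi v - pi f - pi w. Substituting 3 f + w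
    = 2 e turns this into 2 pi (v - e + f). *)

Lemma exact_rank (K : fieldType) (f e v : nat) (C : 'M[K]_(f, e))
    (B : 'M[K]_(e, v)) :
    (forall c : 'rV_f, c *m C = 0 -> c = 0) -> C *m B = 0 ->
    (forall z : 'rV_e, z *m B = 0 -> (z <= C)%MS) -> (0 < v)%N ->
    (forall x : 'rV_v, x *m B^T = 0 <-> exists a, x = const_mx a) ->
  (v + f = e + 1)%N.
Proof.
move=> injC CB0 exB v_gt0 kerBT.
(* The rank of [B] is computed twice: exactness gives e - f, and the one-dimensional kernel of the
   transpose gives v - 1. *)
have rankC : \rank C = f by apply/eqP; exact: inj_row_free injC.
have rkB : \rank (kermx B) = f.
  rewrite -rankC; apply/eqmx_rank/andP; split; last exact/sub_kermxP.
  apply/row_subP => i; apply: exB.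
  by apply/sub_kermxP; rewrite row_sub.
have rkBT : \rank (kermx B^T) = 1%N.
  suff -> : \rank (kermx B^T) = \rank (const_mx 1 : 'rV[K]_v).
    rewrite rank_rV; case: eqP => // /rowP /(_ (Ordinal v_gt0)).
    by rewrite !mxE => /eqP; rewrite oner_eq0.
  apply/eqmx_rank/andP; split; last by apply/sub_kermxP/kerBT; exists 1.
  apply/row_subP => i.
  have /kerBT[a ->] : row i (kermx B^T) *m B^T = 0.
    by apply/sub_kermxP; rewrite row_sub.
  have -> : const_mx a = a *: const_mx 1 :> 'rV[K]_v.
    by apply/rowP => j; rewrite !mxE mulr1.
  exact: scalemx_sub.
move: rkB rkBT; rewrite !mxrank_ker mxrank_tr.
have := rank_leq_col B; have := rank_leq_row B; lia.
Qed.

(** * The mod 2 chain complex of a set of triangles *)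

Section Complex.
Variable V : finType.
Implicit Types (F : {set {set V}}) (e t : {set V}).

Definition edges F : {set {set V}} :=
  [set e : {set V} | (#|e| == 2%N) && [exists t in F, e \subset t]]%SET.

Definition cofaces F e : {set {set V}} := [set t in F | e \subset t]%SET.

(** When every edge has at most two cofaces, this is the mod 2 boundary of the sum of all faces. *)
Definition rim F : {set {set V}} :=
  [set e : {set V} | (#|e| == 2%N) && (#|cofaces F e| == 1%N)]%SET.

Lemma edgesP F e : reflect (#|e| = 2%N /\ exists2 t, t \in F & e \subset t)
  (e \in edges F).
Proof.
rewrite inE; apply: (iffP andP) => [[/eqP ? /exists_inP[t tF et]]|[? [t tF et]]].
  by split=> //; exists t.
by split; [apply/eqP|apply/exists_inP; exists t].
Qed.

Lemma rim_edges F : rim F \subset edges F.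
Proof.
apply/fintype.subsetP => e; rewrite inE => /andP[/eqP e2 /cards1P[t te]].
have := set11 t; rewrite -te inE => /andP[tF et].
by apply/edgesP; split=> //; exists t.
Qed.

(** Both values are even, which is the vanishing of the double boundary of one triangle mod 2. *)
Lemma card_edges_at t v : #|t| = 3%N ->
  #|[set e : {set V} | [&& #|e| == 2%N, v \in e & e \subset t]]%SET|
    = (if v \in t then 2 else 0)%N.
Proof.
move=> t3; case: ifP => vt; last first.
  apply: eq_card0 => e; rewrite inE; apply/negP => /and3P[_ ve /fintype.subsetP et].
  by rewrite et in vt.
have img2 : #|(fun u => [set v; u]%SET) @: (t :\ v)| = 2%N.
  rewrite card_in_imset; first by have := cardsD1 v t; rewrite vt t3 => -[].
  move=> u w; rewrite !inE => /andP[uv _] /andP[wv _] /finset.setP /(_ u).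
  by rewrite !inE eqxx orbT (negPf uv) => /esym/eqP.
rewrite -[RHS]img2; apply: eq_card => e; rewrite inE.
apply/and3P/imsetP => [[e2 ve et]|].
  have /cards2P[x [y [xy E]]] := e2; move: ve et; rewrite {e2}E.
  rewrite !inE => /orP[] /eqP -> /fintype.subsetP st.
    by exists y => //; rewrite !inE eq_sym xy st // !inE eqxx orbT.
  by exists x; rewrite 1?finset.setUC // !inE xy st // !inE eqxx.
move=> [u]; rewrite !inE => /andP[uv ut] ->; split.
- by rewrite cards2 [v == u]eq_sym uv.
- by rewrite !inE eqxx.
- by apply/fintype.subsetP => x; rewrite !inE => /orP[] /eqP ->.
Qed.

Lemma card_edges_in t : #|t| = 3%N ->
  #|[set e : {set V} | (#|e| == 2%N) && (e \subset t)]%SET| = 3%N.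
Proof. by move=> t3; rewrite -[RHS]/('C(3, 2)) -t3 -cards_draws;
  apply: eq_card => e; rewrite !inE andbC. Qed.

(** Double counting of incidences between edges and faces. It serves once in 'F_2, for the double
    boundary, and once in nat, for counting edges. *)
Lemma exchange_edges_faces F (M : nmodType) (P : pred {set V}) (w : {set V} -> M) :
  \sum_(e in edges F | P e) \sum_(t in cofaces F e) w t =
  \sum_(t in F) w t *+ #|[set e : {set V} | [&& #|e| == 2%N, P e & e \subset t]]%SET|.
Proof.
rewrite (exchange_big_dep (mem F)) /=; last first.
  by move=> e t _; rewrite inE => /andP[].
apply: eq_bigr => t tF; rewrite -sumr_const; apply: eq_bigl => e.
rewrite !inE tF /=; case: (#|e| == 2%N); case: (P e); rewrite ?andbF //=.
case: (boolP (e \subset t)) => et; rewrite ?andbF // andbT.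
by rewrite andbT; apply/exists_inP; exists t.
Qed.

Lemma F2_addrr (x : 'F_2) : x + x = 0.
Proof. by apply: addrr_pchar2; rewrite pchar_Fp. Qed.

Lemma F2_cases (x : 'F_2) : x = 0 \/ x = 1.
Proof. by case: x => -[|[|//]] i; [left|right]; apply: val_inj. Qed.

Variable F : {set {set V}}.
Hypothesis card_F : forall t, t \in F -> #|t| = 3%N.

Lemma sum_cofaces_at v (w : {set V} -> 'F_2) :
  \sum_(e in edges F | v \in e) \sum_(t in cofaces F e) w t = 0.
Proof.
rewrite exchange_edges_faces big1 // => t tF.
by rewrite card_edges_at ?card_F//; case: ifP; rewrite // mulr2n F2_addrr.
Qed.

Hypothesis card_cofaces : forall e, e \in edges F -> (#|cofaces F e| <= 2)%N.

Lemma cofacesP e : e \in edges F ->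
  (e \in rim F /\ exists t, cofaces F e = [set t]%SET) \/
  (e \notin rim F /\ exists t t', t != t' /\ cofaces F e = [set t; t']%SET).
Proof.
move=> eE; have /edgesP[e2 [t tF et]] := eE.
have := card_cofaces eE; rewrite leq_eqVlt => /orP[c2|c1].
  right; have /cards2P := c2; split; first by rewrite inE (eqP c2) andbF.
  by [].
have c1' : #|cofaces F e| == 1%N.
  rewrite eqn_leq -ltnS c1; apply/card_gt0P; exists t.
  by rewrite inE tF.
by left; split; [rewrite inE e2 c1'|exact/cards1P].
Qed.

Lemma sum_cofaces1 e : e \in edges F ->
  \sum_(t in cofaces F e) (1 : 'F_2) = (e \in rim F)%:R.
Proof.
move=> /cofacesP[[-> [t ->]]|[/negPf-> [t [t' [tt' ->]]]]].
  by rewrite big_set1.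
by rewrite big_setU1 ?inE //= big_set1 F2_addrr.
Qed.

(** By [sum_cofaces1] the rim is the boundary of the sum of all faces, and a boundary is a cycle:
    every vertex has even degree in the rim. *)
Lemma sum_rim_at v : \sum_(e in rim F | v \in e) (1 : 'F_2) = 0.
Proof.
rewrite -[RHS](sum_cofaces_at v (fun=> 1)) [RHS]big_mkcondr /= big_mkcondr /=.
rewrite [RHS](big_setID (rim F)) /= (finset.setIidPr (rim_edges F)) -[LHS]addr0; congr (_ + _).
  apply: eq_bigr => e er; case: ifP => // _.
  by rewrite sum_cofaces1 ?er // (fintype.subsetP (rim_edges F)).
rewrite big1 // => e; rewrite finset.in_setD => /andP[er eE]; case: ifP => // _.
by rewrite sum_cofaces1 // (negPf er).
Qed.

(** The three geometric inputs: faces carry no nonzero cycle, prescribed even jumps across inner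
    edges come from a function on faces, and the rim is a single cycle. They are supplied by
    [face_rim_neq0], [face_dual_potential] and [rim_even_constant]. *)
Hypothesis rim_neq0 : forall F', F' \subset F -> F' != finset.set0 ->
  exists e, e \in rim F'.
Hypothesis dual_potential : forall z : {set V} -> 'F_2,
  (forall v, \sum_(e in edges F | v \in e) z e = 0) ->
  exists w : {set V} -> 'F_2, forall e t t', e \in edges F ->
    t \in cofaces F e -> t' \in cofaces F e -> t != t' -> w t + w t' = z e.
Hypothesis rim_cycle : forall z : {set V} -> 'F_2,
  (forall v, \sum_(e in rim F | v \in e) z e = 0) ->
  (forall e, e \in rim F -> z e = 0) \/ (forall e, e \in rim F -> z e = 1).

(* Exactness at the edges: for an even [z], the sum of [z] and of the
   coboundary of a dual potential is again even and vanishes off the rim, hence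
   it is [0] or the whole rim, and the rim is the boundary of [F]. *)
Lemma even_is_boundary (z : {set V} -> 'F_2) :
  (forall v, \sum_(e in edges F | v \in e) z e = 0) ->
  exists w : {set V} -> 'F_2,
    forall e, e \in edges F -> \sum_(t in cofaces F e) w t = z e.
Proof.
move=> z_even; have [w wP] := dual_potential z_even.
pose o e := \sum_(t in cofaces F e) w t + z e.
have o_off e : e \in edges F -> e \notin rim F -> o e = 0.
  move=> eE er; have [[]|[_ [t [t' [tt' E]]]]] := cofacesP eE.
    by rewrite (negPf er).
  rewrite /o E big_setU1 ?inE //= big_set1 (wP e) ?F2_addrr // E !inE eqxx //.
  by rewrite orbT.
have o_even v : \sum_(e in rim F | v \in e) o e = 0.
  have : \sum_(e in edges F | v \in e) o e = 0.
    by rewrite big_split /= sum_cofaces_at z_even addr0.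
  rewrite big_mkcondr (big_setID (rim F)) /= (finset.setIidPr (rim_edges F)) -big_mkcondr /=.
  rewrite [X in _ + X]big1 ?addr0 // => e; rewrite finset.in_setD => /andP[er eE].
  by case: ifP => // _; exact: o_off.
have addE (x y : 'F_2) : x + y = 0 -> x = y.
  by move=> xy; rewrite -[RHS]add0r -(F2_addrr x) -addrA xy addr0.
case: (rim_cycle o_even) => o_rim.
  exists w => e eE; apply: addE; have [er|er] := boolP (e \in rim F).
    exact: o_rim.
  exact: o_off.
exists (fun t => w t + 1) => e eE; rewrite big_split /= sum_cofaces1 //.
apply: addE; rewrite addrAC -/(o e); have [er|er] := boolP (e \in rim F).
  by rewrite o_rim // F2_addrr.
by rewrite o_off // addr0.
Qed.

Lemma edge_in_face t u v : t \in F -> u \in t -> v \in t -> u != v ->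
  [set u; v]%SET \in edges F.
Proof.
move=> tF ut vt uv; apply/edgesP; split; first by rewrite cards2 uv.
by exists t => //; apply/fintype.subsetP => x; rewrite !inE => /orP[] /eqP ->.
Qed.

(** Closed under passing to faces with a common vertex, [F'] is a union of components of [F], so an
    edge of [F'] has all its cofaces in [F']. *)
Lemma rim_sub_closed F' : F' \subset F ->
  (forall t t' v, t \in F' -> t' \in F -> v \in t -> v \in t' -> t' \in F') ->
  rim F' \subset rim F.
Proof.
move=> sF F'cl; apply/fintype.subsetP => e; rewrite !inE => /andP[e2 e1]; rewrite e2 /=.
suff <- : cofaces F' e = cofaces F e by [].
have /cards1P[t te] := e1; have := set11 t; rewrite -te inE => /andP[tF' et].
have [v ve] : exists v, v \in e by apply/card_gt0P; rewrite (eqP e2).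
apply/finset.setP => t'; rewrite !inE; apply/idP/idP => /andP[t'F et'].
  by rewrite et' andbT (fintype.subsetP sF).
by rewrite et' andbT (F'cl t t' v) // (fintype.subsetP et, fintype.subsetP et').
Qed.

(** Each level set of [x] is a union of components and therefore contains an edge of the rim. On the
    rim [x] induces an even function [z] of edges, constant by [rim_cycle], so only one value can
    occur. *)
Lemma locally_constant (x : V -> 'F_2) :
  (forall e, e \in edges F -> \sum_(v in e) x v = 0) ->
  forall u v, u \in finset.cover F -> v \in finset.cover F -> x u = x v.
Proof.
move=> x_loc; have x_face t u v : t \in F -> u \in t -> v \in t -> x u = x v.
  move=> tF ut vt; have [->//|uv] := eqVneq u v.
  have := x_loc _ (edge_in_face tF ut vt uv).
  rewrite big_setU1 ?inE //= big_set1 => /eqP; rewrite addr_eq0 => /eqP ->.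
  by apply/eqP; rewrite -subr_eq0 -opprD F2_addrr oppr0.
pose part a := [set t in F | [exists v in t, x v == a]]%SET.
have partP a t v : t \in part a -> v \in t -> x v = a.
  rewrite inE => /andP[tF /exists_inP[u ut /eqP <-]] vt.
  exact: (x_face t).
have part_rim a v : v \in finset.cover F -> x v = a -> exists2 e, e \in rim F &
    forall u, u \in e -> x u = a.
  move=> /bigcupP[t tF vt] xv.
  have part_sub : part a \subset F by apply/fintype.subsetP => s; rewrite inE => /andP[].
  have [|e er] := rim_neq0 part_sub.
    apply/set0Pn; exists t; rewrite inE tF; apply/exists_inP; exists v => //.
    exact/eqP.
  exists e.
    apply: fintype.subsetP e er; apply: rim_sub_closed => // s s' u sp s'F us us'.
    rewrite inE s'F; apply/exists_inP; exists u => //; apply/eqP.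
    exact: partP us.
  move=> u ue; have /edgesP[_ [s sp /fintype.subsetP es]] := fintype.subsetP (rim_edges _) e er.
  exact: partP sp (es _ ue).
pose z e : 'F_2 := [exists v in e, x v == 1]%:R.
have xz e v : e \in rim F -> v \in e -> z e = x v.
  move=> /(fintype.subsetP (rim_edges _)) /edgesP[_ [t tF /fintype.subsetP et]] ve.
  rewrite /z; have -> : [exists u in e, x u == 1] = (x v == 1).
    apply/exists_inP/idP => [[u ue]|]; last by exists v.
    by rewrite (x_face t u v) ?et.
  by case: (F2_cases (x v)) => ->.
have z_even v : \sum_(e in rim F | v \in e) z e = 0.
  rewrite (eq_bigr (fun=> x v * 1)) -?big_distrr /= ?sum_rim_at ?mulr0 //.
  by move=> e /andP[er ve]; rewrite mulr1 (xz _ v).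
suff noboth u v : u \in finset.cover F -> v \in finset.cover F -> x u = 0 -> x v = 1 -> False.
  move=> u v uF vF.
  case: (F2_cases (x u)) (F2_cases (x v)) => xu [] xv; rewrite ?xu ?xv //.
    by case: (noboth u v).
  by case: (noboth v u).
move=> uF vF /(part_rim _ _ uF)[e er ex] /(part_rim _ _ vF)[e' er' ex'].
have mem_ex s : s \in rim F -> exists v, v \in s.
  by rewrite inE => /andP[/eqP s2 _]; apply/card_gt0P; rewrite s2.
have [y ye] := mem_ex _ er; have [y' ye'] := mem_ex _ er'.
case: (rim_cycle z_even) => zc.
  by have := zc _ er'; rewrite (xz _ _ er' ye') ex' // => /eqP; rewrite oner_eq0.
by have := zc _ er; rewrite (xz _ _ er ye) ex // => /esym/eqP; rewrite oner_eq0.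
Qed.

Lemma euler_disc : F != finset.set0 -> (#|finset.cover F| + #|F| = #|edges F| + 1)%N.
Proof.
move=> F0; have [t0 t0F] := set0Pn _ F0.
have [v0 v0t] : exists v, v \in t0 by apply/card_gt0P; rewrite card_F.
have v0F : v0 \in finset.cover F by apply/bigcupP; exists t0.
(* Row vectors are chains: multiplication by [C] and by [B] is the boundary map on faces and on
   edges. *)
pose C : 'M['F_2]_(#|F|, #|edges F|) :=
  \matrix_(i, j) ((enum_val j : {set V}) \subset (enum_val i : {set V}))%:R.
pose B : 'M['F_2]_(#|edges F|, #|finset.cover F|) :=
  \matrix_(j, k) (enum_val k \in (enum_val j : {set V}))%:R.
(* Turns a row vector into a function on sets, with value 0 outside [A]. *)
pose fn (A : {set {set V}}) (c : 'rV['F_2]_#|A|) s :=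
  \sum_(i < #|A|) c 0 i *+ (enum_val i == s).
have fnE A c i : fn A c (enum_val i) = c 0 i.
  rewrite /fn (bigD1 i) //= eqxx mulr1n big1 ?addr0 // => j ji.
  by rewrite (inj_eq enum_val_inj) (negPf ji).
have CE c j : (c *m C) 0 j = \sum_(t in cofaces F (enum_val j)) fn F c t.
  rewrite mxE /cofaces.
  under [RHS]eq_bigl do rewrite inE.
  rewrite [RHS]big_mkcondr /= [RHS]big_enum_val /=; apply: eq_bigr => i _.
  by rewrite mxE fnE; case: ifP; rewrite ?mulr1 ?mulr0.
have BE z k : (z *m B) 0 k =
    \sum_(e in edges F | enum_val k \in e) fn (edges F) z e.
  rewrite mxE [RHS]big_mkcondr /= [RHS]big_enum_val /=; apply: eq_bigr => j _.
  by rewrite mxE fnE; case: ifP; rewrite ?mulr1 ?mulr0.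
have z_even z : z *m B = 0 ->
    forall v, \sum_(e in edges F | v \in e) fn (edges F) z e = 0.
  move=> zB v; have [vF|vF] := boolP (v \in finset.cover F).
    by have /rowP /(_ (enum_rank_in v0F v)) := zB; rewrite BE mxE enum_rankK_in.
  rewrite big_pred0 // => e; apply/negP => /andP[/edgesP[_ [t tF /fintype.subsetP et]] ve].
  by move/negP: vF; apply; apply/bigcupP; exists t; rewrite ?et.
apply: (@exact_rank _ _ _ _ C B).
- move=> c cC0; apply/rowP => i; rewrite mxE -fnE; apply/eqP/negPn/negP => ci.
  (* The support of [c]. An edge on just one face of the support receives a single nonzero term in
     the boundary of [c]. *)
  pose F' := [set t in F | fn F c t != 0]%SET.
  have sF' : F' \subset F by apply/fintype.subsetP => t; rewrite inE => /andP[].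
  have [|e er] := rim_neq0 sF'.
    by apply/set0Pn; exists (enum_val i); rewrite inE enum_valP.
  have /edgesP[e2 [t tF' et]] := fintype.subsetP (rim_edges _) _ er.
  have eE : e \in edges F by apply/edgesP; split=> //; exists t; rewrite ?(fintype.subsetP sF').
  have := er; rewrite inE => /andP[_ /cards1P[s s_e]].
  have /rowP /(_ (enum_rank_in eE e)) := cC0.
  rewrite CE mxE enum_rankK_in // (bigID (mem F')) /=.
  rewrite [X in _ + X]big1 ?addr0; last first.
    by move=> r /andP[]; rewrite !inE => /andP[-> _] /negPn /eqP.
  rewrite (eq_bigl (mem [set s]%SET)); last first.
    move=> r; rewrite -s_e !inE; case: (boolP (r \in F)) => //= _.
    by rewrite andbC.
  rewrite big_set1 => s0; have := set11 s; rewrite -s_e !inE s0 eqxx.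
  by rewrite andbF.
- apply/row_matrixP => i; rewrite row_mul row0; apply/rowP => k.
  rewrite BE mxE -[RHS](sum_cofaces_at (enum_val k) (fn F (delta_mx 0 i))).
  apply: eq_bigr => e /andP[eE _].
  have := CE (delta_mx 0 i) (enum_rank_in eE e).
  by rewrite -rowE enum_rankK_in // => <-; rewrite -fnE enum_rankK_in.
- move=> z /z_even /even_is_boundary[w wz].
  apply/submxP; exists (\row_i w (enum_val i)); apply/rowP => j.
  rewrite CE -fnE -wz ?enum_valP //; apply: eq_bigr => t; rewrite inE => /andP[tF _].
  by rewrite -(enum_rankK_in tF tF) fnE mxE.
- by apply/card_gt0P; exists v0.
- pose fv (x : 'rV['F_2]_#|finset.cover F|) v := \sum_(i < #|finset.cover F|) x 0 i *+ (enum_val i == v).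
  have fvE x i : fv x (enum_val i) = x 0 i.
    rewrite /fv (bigD1 i) //= eqxx mulr1n big1 ?addr0 // => j ji.
    by rewrite (inj_eq enum_val_inj) (negPf ji).
  have BTE x j : (x *m B^T) 0 j = \sum_(v in enum_val j) fv x v.
    rewrite mxE (eq_bigl (fun v => (v \in finset.cover F) && (v \in enum_val j))).
      rewrite [RHS]big_mkcondr /= [RHS]big_enum_val /=; apply: eq_bigr => i _.
      by rewrite !mxE fvE; case: ifP; rewrite ?mulr1 ?mulr0.
    move=> v; have [vj|] := boolP (v \in enum_val j); rewrite ?andbF // andbT.
    have /edgesP[_ [t tF /fintype.subsetP et]] := enum_valP j.
    by apply/esym/bigcupP; exists t; rewrite ?et.
  move=> x; split=> [xB0|[a ->]].
    exists (fv x v0); apply/rowP => i; rewrite !mxE -fvE.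
    apply: locally_constant; rewrite ?enum_valP // => e eE.
    by have /rowP /(_ (enum_rank_in eE e)) := xB0; rewrite BTE mxE enum_rankK_in.
  apply/rowP => j; rewrite BTE mxE.
  have /edgesP[/eqP e2 [t tF /fintype.subsetP et]] := enum_valP j.
  rewrite (eq_bigr (fun=> a)); last first.
    move=> v vj; have vF : v \in finset.cover F by apply/bigcupP; exists t; rewrite ?et.
    by rewrite -(enum_rankK_in vF vF) fvE mxE.
  by rewrite sumr_const (eqP e2) mulr2n F2_addrr.
Qed.

(** Incidences counted from both sides: three edges per face, two faces per edge except for one on
    the rim. *)
Lemma card_faces_edges : (3 * #|F| + #|rim F| = 2 * #|edges F|)%N.
Proof.
have := exchange_edges_faces F predT (fun=> 1%N).
rewrite [X in _ = X -> _](eq_bigr (fun=> 3%N)); last first.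
  move=> t tF; rewrite (_ : #|_| = 3%N) //; rewrite -(card_edges_in (card_F tF)).
  by apply: eq_card => e; rewrite !inE.
rewrite sum_nat_const => cnt.
have : (\sum_(e in edges F | true) (\sum_(t in cofaces F e) 1 + (e \in rim F)) = 2 * #|edges F|)%N.
  rewrite mulnC -sum_nat_const; apply: eq_big => [e|e]; rewrite andbT // => eE.
  rewrite sum1_card; have [[-> [t ->]]|[/negPf-> [t [t' [tt' ->]]]]] := cofacesP eE.
    by rewrite cards1.
  by rewrite cards2 tt'.
rewrite big_split /= => <-; congr (_ + _)%N.
  by rewrite mulnC -cnt.
rewrite -sum1_card big_mkcond [RHS]big_mkcondr /= [RHS]big_mkcond /=.
apply: eq_bigr => e _; have [er|//] := boolP (e \in rim F); last by case: ifP.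
by rewrite (fintype.subsetP (rim_edges F)).
Qed.

End Complex.

(** * The angle sum of a triangle *)

Section Angles.
Variable R : realType.

Definition cosine_law (a b c : R) : R := (a ^+ 2 + b ^+ 2 - c ^+ 2) / (2 * a * b).

Lemma cosine_law_bound (a b c : R) : 0 < a -> 0 < b -> 0 < c ->
  a < b + c -> b < a + c -> c < a + b -> -1 <= cosine_law a b c <= 1.
Proof.
move=> a0 b0 c0 abc bac cab; have ab0 : 0 < 2 * a * b by rewrite !mulr_gt0.
rewrite /cosine_law ler_pdivlMr // ler_pdivrMr //; apply/andP; split; nra.
Qed.

(* By Heron's formula, S / (2 a b) is the sine of the angle between a and b. *)
Lemma sin_cosine_law (a b c : R) : 0 < a -> 0 < b -> 0 < c ->
  a < b + c -> b < a + c -> c < a + b ->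
  sin (acos (cosine_law a b c)) =
  Num.sqrt ((a + b + c) * (a + b - c) * (a + c - b) * (b + c - a)) / (2 * a * b).
Proof.
move=> a0 b0 c0 abc bac cab; have ab0 : 0 < 2 * a * b by rewrite !mulr_gt0.
rewrite sin_acos ?cosine_law_bound //.
have -> : 1 - cosine_law a b c ^+ 2 =
  ((a + b + c) * (a + b - c) * (a + c - b) * (b + c - a)) * (2 * a * b)^-1 ^+ 2.
  by rewrite /cosine_law; field; rewrite !gt_eqF.
rewrite sqrtrM; last by rewrite !mulr_ge0 //; lra.
by rewrite sqrtr_sqr ger0_norm // invr_ge0 ltW.
Qed.

(** The Heron product is symmetric in the sides, so the sines of [x] and [y] share the numerator
    [S]. The addition formula then shows that pi - (x + y) has the cosine of the third angle. *)
Lemma triangle_angle_sum (a b c : R) : 0 < a -> 0 < b -> 0 < c ->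
  a < b + c -> b < a + c -> c < a + b ->
  acos (cosine_law a b c) + acos (cosine_law b c a) + acos (cosine_law c a b) = pi.
Proof.
move=> a0 b0 c0 abc bac cab.
have [A B C] : [/\ -1 <= cosine_law a b c <= 1, -1 <= cosine_law b c a <= 1
    & -1 <= cosine_law c a b <= 1].
  by split; apply: cosine_law_bound => //; lra.
have sA := sin_cosine_law a0 b0 c0 abc bac cab.
have sB : sin (acos (cosine_law b c a)) = Num.sqrt
    ((a + b + c) * (a + b - c) * (a + c - b) * (b + c - a)) / (2 * b * c).
  by rewrite sin_cosine_law //; try lra; congr (Num.sqrt _ / _); ring.
set S := Num.sqrt _ in sA sB.
have S0 : 0 < S by rewrite sqrtr_gt0 !mulr_gt0 //; lra.
have S2 : S ^+ 2 = (a + b + c) * (a + b - c) * (a + c - b) * (b + c - a).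
  by rewrite sqr_sqrtr // !mulr_ge0 //; lra.
set x := acos (cosine_law a b c) in sA *; set y := acos (cosine_law b c a) in sB *.
have cx : cos x = cosine_law a b c by rewrite /x acosK // in_itv.
have cy : cos y = cosine_law b c a by rewrite /y acosK // in_itv.
have x0 : 0 <= x by exact: acos_ge0.
have y0 : 0 <= y by exact: acos_ge0.
have xpi : x <= pi by exact: acos_lepi.
have ypi : y <= pi by exact: acos_lepi.
have cxy : cos (pi - (x + y)) = cosine_law c a b.
  rewrite addrC cosDpi cosN cosD cx cy sA sB.
  have -> : S / (2 * a * b) * (S / (2 * b * c)) = S ^+ 2 / (4 * a * b * b * c).
    by field; rewrite !gt_eqF.
  by rewrite S2 /cosine_law; field; rewrite !gt_eqF.
have sxy : 0 < sin (x + y).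
  rewrite sinD cx cy sA sB.
  have -> : S / (2 * a * b) * cosine_law b c a + cosine_law a b c * (S / (2 * b * c))
     = S / (2 * a * c).
    by rewrite /cosine_law; field; rewrite !gt_eqF.
  by rewrite divr_gt0 // !mulr_gt0.
(* Places pi - (x + y) in the interval where [acos] inverts [cos]: beyond pi the sine of x + y could
   not be positive. *)
have xy : x + y <= pi.
  rewrite leNgt; apply/negP => xy.
  have : 0 <= sin (x + y - pi) by apply: sin_ge0_pi; lra.
  rewrite -[x + y - pi]opprK sinN opprB addrC sinDpi sinN; lra.
by rewrite -cxy cosK; [lra | rewrite in_itv /=; lra].
Qed.

End Angles.

(** * Convex hulls and barycentric coordinates *)

Local Open Scope classical_set_scope.
Local Open Scope ring_scope.

Lemma cards3P (T : finType) (t : {set T}) : #|t| = 3%N ->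
  exists a b c, [/\ a != b, a != c, b != c & t = [set a; b; c]%SET].
Proof.
move=> t3; have [a at_] : exists a, a \in t by apply/card_gt0P; rewrite t3.
have /cards2P[b [c [bc E]]] : #|(t :\ a)%SET| == 2%N.
  by have := cardsD1 a t; rewrite at_ t3 add1n => -[<-].
have /setD1P[ba _] : b \in (t :\ a)%SET by rewrite E !inE eqxx.
have /setD1P[ca _] : c \in (t :\ a)%SET by rewrite E !inE eqxx orbT.
exists a, b, c; split; rewrite // 1?eq_sym //.
by rewrite -(finset.setD1K at_) E finset.setUA.
Qed.

Section Plane.
Variable R : realType.
Implicit Types (x y p q d : 'rV[R]_2) (A : set 'rV[R]_2).

Lemma rV2_eq x y : x 0 0 = y 0 0 -> x 0 1 = y 0 1 -> x = y.
Proof.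
move=> x0 x1; apply/rowP => i; case: i => -[|[|//]] i.
  by rewrite (_ : Ordinal i = 0) //; exact: val_inj.
by rewrite (_ : Ordinal i = 1) //; exact: val_inj.
Qed.

Lemma affine_form_continuous (k0 k1 k2 : R) :
  continuous (fun q : 'rV[R]_2 => k0 + k1 * q 0 0 + k2 * q 0 1).
Proof.
move=> q; apply: (@cvgD R R _ (nbhs q) _ (fun q : 'rV[R]_2 => k0 + k1 * q 0 0)
  (fun q : 'rV[R]_2 => k2 * q 0 1)).
  apply: (@cvgD R R _ (nbhs q) _ (cst k0) (fun q : 'rV[R]_2 => k1 * q 0 0)).
    exact: cvg_cst.
  apply: (@cvgM R _ (nbhs q) _ (cst k1) (fun q : 'rV[R]_2 => q 0 0)).
    exact: cvg_cst.
  exact: coord_continuous.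
apply: (@cvgM R _ (nbhs q) _ (cst k2) (fun q : 'rV[R]_2 => q 0 1)).
  exact: cvg_cst.
exact: coord_continuous.
Qed.

Lemma line_continuous x d : continuous (fun s : R => x + s *: d).
Proof. by move=> s; apply: cvgD; [exact: cvg_cst|apply: cvgZr_tmp; exact: cvg_id]. Qed.

Lemma nbhs_line x d A : nbhs x A ->
  exists2 e : R, 0 < e & forall s, `|s| < e -> A (x + s *: d).
Proof.
move=> xA; have : nbhs (0 : R) [set s | A (x + s *: d)].
  by apply: (@line_continuous x d 0 A); rewrite /= scale0r addr0.
move=> /nbhs_ballP[e e0 eA]; exists e => // s se.
by apply: eA; rewrite -ball_normE /ball_ /= sub0r normrN.
Qed.

(** The parameters whose point lies in [A] form a nonempty clopen subset of the connected
    interval. *)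
Lemma segment_clopen A p q : closed A -> A p ->
  (forall s : R, 0 <= s <= 1 -> A (p + s *: (q - p)) ->
     nbhs (p + s *: (q - p)) A) -> A q.
Proof.
move=> cA Ap opA; pose f s := p + s *: (q - p).
have fc : continuous f by exact: line_continuous.
have : `[0, 1]%classic `&` f @^-1` A = `[0, 1]%classic :> set R.
  apply: (@segment_connected R 0 1).
  - exists 0; split; first by rewrite /= in_itv /= lexx ler01.
    by rewrite /f /= scale0r addr0.
  - exists (f @^-1` A°).
      by apply: open_comp; [move=> s _; exact: fc|exact: open_interior].
    apply/seteqP; split=> s /= [s01 fs]; split=> //.
      by apply: opA => //; rewrite in_itv in s01.
    exact: interior_subset fs.
  - exists (f @^-1` A) => //.
    by apply: preimage_closed => // s _; exact: fc.
move=> /seteqP[_ /(_ 1)]; rewrite /= in_itv /= lexx ler01 => /(_ isT)[_].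
by rewrite /f scale1r addrC subrK.
Qed.

End Plane.

Section Hulls.
Variables (R : realType) (V : finType) (pos : V -> 'rV[R]_2).
Implicit Types (x y p q : 'rV[R]_2) (s t e r : {set V}) (w : V -> R).

(** The relative interior of the simplex when the vertices are affinely independent; a single vertex
    is its own open hull. *)
Definition open_hull s : set 'rV[R]_2 :=
  [set x | exists w : V -> R, [/\ forall v, v \in s -> 0 < w v,
     \sum_(v in s) w v = 1 & x = \sum_(v in s) w v *: pos v]].

Lemma sum_subset (M : nmodType) s t (f : V -> M) : s \subset t ->
  \sum_(v in t) (if v \in s then f v else 0) = \sum_(v in s) f v.
Proof.
move=> st; rewrite -big_mkcondr; apply: eq_bigl => v /=.
by case: (boolP (v \in s)) => [/(fintype.subsetP st)->|]; rewrite ?andbF.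
Qed.

Lemma open_hull_hull s : open_hull s `<=` hull pos s.
Proof. by move=> x [w [w0 w1 ->]]; exists w; split=> // v /w0 /ltW. Qed.

Lemma hull_open_hull s x : hull pos s x ->
  exists2 r : {set V}, r \subset s & open_hull r x.
Proof.
(* The face sought is the support of the weights. *)
move=> [w [w0 w1 ->]]; exists [set v in s | 0 < w v]%SET.
  by apply/fintype.subsetP => v; rewrite inE => /andP[].
have sub : [set v in s | 0 < w v]%SET \subset s.
  by apply/fintype.subsetP => v; rewrite inE => /andP[].
have wE v : v \in s -> (if v \in [set v in s | 0 < w v]%SET then w v else 0) = w v.
  by move=> vs; rewrite inE vs lt0r w0 // andbT; case: eqVneq.
exists w; split; first by move=> v; rewrite inE => /andP[].
  by rewrite -w1 -(sum_subset _ sub); exact: eq_bigr.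
rewrite -(sum_subset _ sub); apply: eq_bigr => v vs.
by rewrite -[in LHS](wE v vs); case: ifP; rewrite ?scale0r.
Qed.

Lemma hull_subset s t : s \subset t -> hull pos s `<=` hull pos t.
Proof.
move=> st x [w [w0 w1 ->]]; exists (fun v => if v \in s then w v else 0).
split; first by move=> v _; case: ifP => // /w0.
  by rewrite sum_subset.
rewrite -(sum_subset _ st); apply: eq_bigr => v _.
by case: ifP; rewrite ?scale0r.
Qed.

Lemma open_hull_convex s x y (k : R) : open_hull s x -> hull pos s y ->
  0 <= k < 1 -> open_hull s (x + k *: (y - x)).
Proof.
move=> [w [w0 w1 ->]] [w' [w'0 w'1 ->]] k01.
exists (fun v => w v + k * (w' v - w v)); split.
- move=> v vs; have := w0 v vs; have := w'0 v vs; nra.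
- by rewrite big_split /= -big_distrr /= sumrB w1 w'1 subrr mulr0 addr0.
- rewrite -sumrB scaler_sumr -big_split /=; apply: eq_bigr => v _.
  by rewrite scalerDl -scalerA scalerBl.
Qed.

Definition barycenter s : 'rV[R]_2 := \sum_(v in s) #|s|%:R^-1 *: pos v.

Lemma barycenter_open_hull s : s != finset.set0 -> open_hull s (barycenter s).
Proof.
rewrite -card_gt0 => s0; exists (fun=> #|s|%:R^-1); split => //.
  by move=> v _; rewrite invr_gt0 ltr0n.
by rewrite sumr_const -[LHS]mulr_natl divff // pnatr_eq0 -lt0n.
Qed.

Lemma open_hull1 v : open_hull [set v]%SET (pos v).
Proof.
by exists (fun=> 1); split; rewrite ?big_set1 ?scale1r.
Qed.

Lemma hull_vertex s v : v \in s -> hull pos s (pos v).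
Proof.
move=> vs; apply: (@hull_subset [set v]%SET); first by rewrite finset.sub1set.
exact/open_hull_hull/open_hull1.
Qed.

Lemma hull0 x : ~ hull pos finset.set0 x.
Proof. by move=> [w [_ + _]]; rewrite big_set0 => /esym/eqP; rewrite oner_eq0. Qed.

Lemma affine_unique t w w' : affinely_independent pos t ->
  \sum_(v in t) w v = \sum_(v in t) w' v ->
  \sum_(v in t) w v *: pos v = \sum_(v in t) w' v *: pos v ->
  forall v, v \in t -> w v = w' v.
Proof.
move=> ind ww' wpos v vt; apply/eqP; rewrite -subr_eq0; apply/eqP.
apply: (ind (fun v => w v - w' v)) vt; first by rewrite sumrB ww' subrr.
by under eq_bigr do rewrite scalerBl; rewrite sumrB wpos subrr.
Qed.

(** Extended by zero, both weight functions are the unique coordinates of [x] in [t]. They are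
    positive on [s] and vanish off [r]. *)
Lemma open_hull_sub t s r x : affinely_independent pos t -> s \subset t ->
  r \subset t -> open_hull s x -> hull pos r x -> s \subset r.
Proof.
move=> ind st rt [w [w0 w1 ->]] [w' [w'0 w'1 ww']].
apply/fintype.subsetP => v vs.
have vt := fintype.subsetP st _ vs.
have := @affine_unique t (fun v => if v \in s then w v else 0)
  (fun v => if v \in r then w' v else 0) ind.
rewrite !sum_subset // w1 w'1.
have E (f : V -> R) (u : {set V}) : u \subset t ->
    \sum_(v in t) (if v \in u then f v else 0) *: pos v = \sum_(v in u) f v *: pos v.
  move=> ut; rewrite -(sum_subset _ ut); apply: eq_bigr => z _.
  by case: ifP; rewrite ?scale0r.
rewrite !E // => /(_ erefl ww' v vt); rewrite vs; case: ifP => // _ wv.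
by have := w0 v vs; rewrite wv ltxx.
Qed.

(** The coordinates are taken on the whole plane and not only on the triangle: the sign of [b a]
    tells the side of the edge opposite to [a]. *)
Definition barycentric t (b : V -> 'rV[R]_2 -> R) : Prop :=
  [/\ forall v, continuous (b v), forall q, \sum_(v in t) b v q = 1
    & forall q, q = \sum_(v in t) b v q *: pos v].

Lemma barycentric_exists t : #|t| = 3%N -> affinely_independent pos t ->
  exists b, barycentric t b.
Proof.
move=> /cards3P[i [j [k [ij ik jk ->]]]] ind.
have sum3 (M : nmodType) (f : V -> M) :
    \sum_(v in [set i; j; k]%SET) f v = f i + f j + f k.
  by rewrite -finset.setUA !big_setU1 ?inE ?negb_or ?ij ?ik //= big_set1 addrA.
pose cr (x y : 'rV[R]_2) := x 0 0 * y 0 1 - x 0 1 * y 0 0.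
pose D := cr (pos j - pos i) (pos k - pos i).
have D0 : D != 0.
  apply/eqP; rewrite /D /cr !mxE => D0.
  have dep (u v : R) : u *: (pos j - pos i) + v *: (pos k - pos i) = 0 -> u = 0 /\ v = 0.
    move=> uv; pose w z := if z == i then - (u + v) else if z == j then u else v.
    have wi : w i = - (u + v) by rewrite /w eqxx.
    have wj : w j = u by rewrite /w eq_sym (negPf ij) eqxx.
    have wk : w k = v by rewrite /w eq_sym (negPf ik) eq_sym (negPf jk).
    have := ind w; rewrite !sum3 wi wj wk => /(_ _ _) h.
    split; [rewrite -wj|rewrite -wk]; (apply: h; rewrite ?inE ?eqxx ?orbT //; first lra);
      by apply/rowP => n; move/rowP/(_ n): uv; rewrite !mxE; lra.
  have E0 u v : u * (pos j 0 0 - pos i 0 0) + v * (pos k 0 0 - pos i 0 0) = 0 ->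
      u * (pos j 0 1 - pos i 0 1) + v * (pos k 0 1 - pos i 0 1) = 0 -> u = 0 /\ v = 0.
    by move=> h0 h1; apply: dep; apply: rV2_eq; rewrite !mxE.
  (* If [D] vanishes, the coordinates of one side vector, crossed with those of the other, are
     coefficients of a linear relation. Independence then forces the side vectors to vanish, and the
     coefficients 1 and 0 give a contradiction. *)
  have [h1 h2] : pos k 0 1 - pos i 0 1 = 0 /\ - (pos j 0 1 - pos i 0 1) = 0.
    by apply: E0; [rewrite -[RHS]D0|]; ring.
  have [h3 h4] : pos k 0 0 - pos i 0 0 = 0 /\ - (pos j 0 0 - pos i 0 0) = 0.
    by apply: E0; [|rewrite -[RHS]oppr0 -D0]; ring.
  have [/eqP] : 1 = 0 :> R /\ 0 = 0 :> R by apply: E0; lra.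
  by rewrite oner_eq0.
(* Cramer's rule: the signed area of the triangle [q], [y], [z] over that of the whole triangle,
   expanded as an affine form in [q]. *)
pose a (y z : 'rV[R]_2) (q : 'rV[R]_2) :=
  D^-1 * cr y z + D^-1 * (y 0 1 - z 0 1) * q 0 0 + D^-1 * (z 0 0 - y 0 0) * q 0 1.
exists (fun v => if v == i then a (pos j) (pos k)
  else if v == j then a (pos k) (pos i) else a (pos i) (pos j)).
have ji : (j == i) = false by rewrite eq_sym (negPf ij).
have ki : (k == i) = false by rewrite eq_sym (negPf ik).
have kj : (k == j) = false by rewrite eq_sym (negPf jk).
split.
- by move=> v; case: ifP => _; [|case: ifP => _]; exact: affine_form_continuous.
- move=> q; rewrite sum3 !eqxx ji ki kj /a /cr.
  transitivity (D^-1 * D); last by rewrite mulVf.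
  rewrite /D /cr !mxE; ring.
- move=> q; rewrite sum3 !eqxx ji ki kj /a /cr.
  apply: rV2_eq; rewrite !mxE.
    transitivity (D^-1 * D * q 0 0); first by rewrite mulVf // mul1r.
    rewrite {2}/D /cr !mxE; ring.
  transitivity (D^-1 * D * q 0 1); first by rewrite mulVf // mul1r.
  rewrite {2}/D /cr !mxE; ring.
Qed.

Section Barycentric.
Variables (t : {set V}) (b : V -> 'rV[R]_2 -> R).
Hypotheses (ind : affinely_independent pos t) (bP : barycentric t b).

Lemma barycentric_unique w q v : \sum_(v in t) w v = 1 ->
  q = \sum_(v in t) w v *: pos v -> v \in t -> b v q = w v.
Proof.
have [_ b1 bq] := bP; move=> w1 qw; apply: (@affine_unique t (b ^~ q) w ind).
  by rewrite w1.
by rewrite -bq.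
Qed.

Lemma barycentric_affine v x d (k : R) : v \in t ->
  b v (x + k *: d) = b v x + k * (b v (x + d) - b v x).
Proof.
have [_ b1 bq] := bP; move=> vt.
apply: (@barycentric_unique (fun v => b v x + k * (b v (x + d) - b v x))) => //.
  by rewrite big_split /= -big_distrr /= sumrB !b1 subrr mulr0 addr0.
have {1}-> : x + k *: d = x + k *: (x + d - x) by rewrite [x + d]addrC addrK.
rewrite {1 3}(bq x) {1}(bq (x + d)) -sumrB scaler_sumr -big_split /=.
by apply: eq_bigr => u _; rewrite -scalerBl scalerA -scalerDl.
Qed.

Lemma barycentric_vertex u v : u \in t -> v \in t -> b u (pos v) = (u == v)%:R.
Proof.
move=> ut vt; apply: (@barycentric_unique (fun u => (u == v)%:R)) => //.
  by rewrite (bigD1 v) //= eqxx big1 ?addr0 // => z /andP[_ /negPf->].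
rewrite (bigD1 v) //= eqxx scale1r big1 ?addr0 // => z /andP[_ /negPf->].
by rewrite scale0r.
Qed.

Lemma open_hullP x : open_hull t x <-> forall v, v \in t -> 0 < b v x.
Proof.
have [_ b1 bq] := bP; split=> [[w [w0 w1 xw]] v vt|b0].
  by rewrite (barycentric_unique w1 xw) ?w0.
by exists (b ^~ x); split.
Qed.

Lemma hullP s x : s \subset t -> hull pos s x <->
  (forall v, v \in t -> if v \in s then is_true (0 <= b v x) else b v x = 0).
Proof.
have [_ b1 bq] := bP; move=> st; split=> [[w [w0 w1 xw]] v vt|b0].
  have E : b v x = if v \in s then w v else 0.
    apply: (@barycentric_unique (fun v => if v \in s then w v else 0)) => //.
      by rewrite sum_subset.
    rewrite xw -(sum_subset _ st); apply: eq_bigr => z _.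
    by case: ifP; rewrite ?scale0r.
  by rewrite E; case: (boolP (v \in s)) => // vs; exact: w0.
have bs v : v \in t -> (if v \in s then b v x else 0) = b v x.
  by move=> vt; have := b0 v vt; case: ifP.
exists (b ^~ x); split=> [v vs||].
- by have := b0 v (fintype.subsetP st _ vs); rewrite vs.
- by rewrite -(b1 x) -(sum_subset _ st); apply: eq_bigr.
- rewrite {1}(bq x) -(sum_subset _ st); apply: eq_bigr => v vt.
  by rewrite -[in LHS](bs v vt); case: ifP; rewrite ?scale0r.
Qed.

Lemma hull_closed s : s \subset t -> closed (hull pos s).
Proof.
have [bc _ _] := bP; move=> st.
have -> : hull pos s = \bigcap_(v in [set` t])
    (b v @^-1` (if v \in s then [set y | 0 <= y] else [set y | y = 0])).
  apply/seteqP; split=> x.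
    by move=> /(hullP _ st) h v vt /=; have := h v vt; case: ifP.
  by move=> h; apply/(hullP _ st) => v vt; have := h v vt; rewrite /=; case: ifP.
apply: closed_bigI => v _; apply: preimage_closed; first by move=> q _; exact: bc.
by case: ifP => _; [exact: closed_ge|exact: closed_eq].
Qed.

Lemma open_hull_near x : open_hull t x -> \forall q \near x, open_hull t q.
Proof.
have [bc _ _] := bP; move=> /open_hullP b0.
have : \forall q \near x, forall v, v \in t -> 0 < b v q.
  apply: (@filter_forall _ V (fun v q => v \in t -> 0 < b v q) (nbhs x)) => v.
  have [vt|vt] := boolP (v \in t); last exact: nearW.
  have : \forall q \near x, 0 < b v q.
    by apply: (bc v x [set y | 0 < y]); apply: open_nbhs_nbhs; split; [exact: open_gt|exact: b0].
  by apply: filterS.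
by apply: filterS => q /open_hullP.
Qed.

(** Near a point of the open edge the other two coordinates stay positive, so the sign of [b a]
    alone decides. *)
Lemma facet_near a x : a \in t -> open_hull (t :\ a)%SET x ->
  \forall q \near x, (0 <= b a q -> hull pos t q) /\ (0 < b a q -> open_hull t q).
Proof.
have [bc b1 _] := bP; move=> at_ xe.
have bx v : v \in t -> v != a -> 0 < b v x.
  move=> vt va; have [w [w0 w1 xw]] := xe.
  have vin : v \in (t :\ a)%SET by rewrite !inE va.
  rewrite (@barycentric_unique (fun v => if v \in (t :\ a)%SET then w v else 0)) //.
  - by rewrite vin w0.
  - by rewrite sum_subset // subD1set.
  - rewrite xw -(sum_subset _ (subD1set t a)); apply: eq_bigr => z _.
    by case: ifP; rewrite ?scale0r.
have : \forall q \near x, forall v, v \in t -> v != a -> 0 < b v q.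
  apply: (@filter_forall _ V (fun v q => v \in t -> v != a -> 0 < b v q) (nbhs x)) => v.
  have [vt|vt] := boolP (v \in t); last exact: nearW.
  have [->|va] := eqVneq v a; first exact: nearW.
  have : \forall q \near x, 0 < b v q.
    by apply: (bc v x [set y | 0 < y]); apply: open_nbhs_nbhs; split; [exact: open_gt|exact: bx].
  by apply: filterS.
apply: filterS => q bq; split=> ba.
  apply/(hullP _ (fintype.subxx t)) => v vt; rewrite vt.
  by have [->//|va] := eqVneq v a; rewrite ltW ?bq.
apply/open_hullP => v vt; have [->//|va] := eqVneq v a.
exact: bq.
Qed.

Lemma barycentric_facet a x : a \in t -> hull pos (t :\ a)%SET x -> b a x = 0.
Proof.
move=> at_ /(hullP _ (subD1set t a)) /(_ a at_).
by rewrite !inE eqxx.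
Qed.

End Barycentric.
End Hulls.

(** * The frontier of a set of triangles *)

Section Triangulated.
Variables (R : realType) (V : finType) (pos : V -> 'rV[R]_2).
Variable T : {set {set V}}.
Hypothesis triT : triangulation pos T.
Implicit Types (x y p q : 'rV[R]_2) (s t e r : {set V}) (F : {set {set V}}).

Let card_T t : t \in T -> #|t| = 3%N := @triangulation_card _ _ _ _ triT t.
Let indT t : t \in T -> affinely_independent pos t :=
  @triangulation_nondegenerate _ _ _ _ triT t.

Lemma face_coordinates t : t \in T -> exists b, barycentric pos t b.
Proof. by move=> tT; apply: barycentric_exists; [exact: card_T|exact: indT]. Qed.

Lemma face_hull_closed s t : t \in T -> s \subset t -> closed (hull pos s).
Proof.
move=> tT; have [b bP] := face_coordinates tT.
exact: hull_closed (indT tT) bP s.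
Qed.

(** Puts the three cases of [triangulation_meet] and the case [t = t'] into one form. *)
Lemma meet_common_face t t' : t \in T -> t' \in T ->
  exists r : {set V}, [/\ r \subset t, r \subset t'
    & hull pos t `&` hull pos t' = hull pos r].
Proof.
move=> tT tT'; have [<-|tt'] := eqVneq t t'.
  by exists t; rewrite fintype.subxx setIid.
case: (triangulation_meet triT tT tT' tt') => [->|[v [vt vt' ->]]|[u [v [uv]]]].
- exists finset.set0; rewrite !finset.sub0set; split=> //.
  by apply/esym/seteqP; split=> // x /hull0.
- exists [set v]%SET; rewrite !finset.sub1set; split=> //.
  apply/seteqP; split=> x /= => [->|[w [_]]]; first by apply: hull_vertex; rewrite inE.
  by rewrite !big_set1 => -> ->; rewrite scale1r.
- move=> /andP[ut vt] /andP[ut' vt'] ->; exists [set u; v]%SET.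
  by split=> //; apply/fintype.subsetP => x; rewrite !inE => /orP[] /eqP ->.
Qed.

Lemma open_hull_sub_face s t r t' x : t \in T -> s \subset t -> t' \in T ->
  r \subset t' -> open_hull pos s x -> hull pos r x -> s \subset r.
Proof.
move=> tT st tT' rt' sx rx.
have [u [ut ut' E]] := meet_common_face tT tT'.
have ux : hull pos u x.
  by rewrite -E; split; [apply: hull_subset st _ (open_hull_hull sx)|apply: hull_subset rt' _ rx].
have su := open_hull_sub (indT tT) st ut sx ux.
exact: open_hull_sub (indT tT') (fintype.subset_trans su ut') rt' sx rx.
Qed.

Lemma vertex_in_face v t s : t \in T -> s \subset t -> hull pos s (pos v) -> v \in s.
Proof.
move=> tT st sv; have [t' tT' vt'] := triangulation_cover triT v.
rewrite -finset.sub1set; apply: (open_hull_sub_face tT' _ tT st (open_hull1 pos v) sv).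
by rewrite finset.sub1set.
Qed.

(** The hulls are closed and finite in number, so near [x] only those through [x] are met. *)
Lemma hull_away_near x : \forall q \near x, forall s t, t \in T -> s \subset t ->
  ~ hull pos s x -> ~ hull pos s q.
Proof.
apply: (@filter_forall _ _ (fun s q => forall t, t \in T -> s \subset t ->
  ~ hull pos s x -> ~ hull pos s q) (nbhs x)) => s.
apply: (@filter_forall _ _ (fun t q => t \in T -> s \subset t ->
  ~ hull pos s x -> ~ hull pos s q) (nbhs x)) => t.
have [/andP[tT st]|h] := boolP ((t \in T) && (s \subset t)); last first.
  by apply: nearW => q tT st; rewrite tT st in h.
have [sx|sx] := pselect (hull pos s x); first exact: nearW.
have : nbhs x (~` hull pos s).
  apply: open_nbhs_nbhs; split=> //; apply: closed_openC.
  exact: face_hull_closed tT st.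
by apply: filterS.
Qed.

Lemma carrierP F x : carrier pos F x <-> exists2 t, t \in F & hull pos t x.
Proof. by split=> [[t tF tx]|[t tF tx]]; exists t. Qed.

Lemma carrier_subset F F' : F \subset F' -> carrier pos F `<=` carrier pos F'.
Proof. by move=> /fintype.subsetP sF x [t tF tx]; exists t => //; apply: sF. Qed.

Lemma carrier_closed F : F \subset T -> closed (carrier pos F).
Proof.
move=> /fintype.subsetP sF; apply: closed_bigcup; first exact: finite_finset.
by move=> t tF; apply: (@face_hull_closed t t); rewrite ?fintype.subxx ?sF.
Qed.

Lemma carrier_open_hull F t x : F \subset T -> t \in T -> open_hull pos t x ->
  carrier pos F x -> t \in F.
Proof.
move=> /fintype.subsetP sF tT tx /carrierP[t' tF tx'].
have tT' := sF _ tF.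
have tt' : t \subset t'.
  exact: (open_hull_sub_face tT (fintype.subxx t) tT' (fintype.subxx t') tx tx').
by have /eqP -> : t == t' by rewrite finset.eqEcard tt' !card_T.
Qed.

Lemma apex t e : t \in T -> e \subset t -> #|e| = 2%N ->
  exists2 a, a \in t & e = (t :\ a)%SET.
Proof.
move=> tT et e2; have : #|(t :\: e)%SET| == 1%N.
  by rewrite cardsD (finset.setIidPr et) card_T // e2.
move=> /cards1P[a E]; exists a; first by have := set11 a; rewrite -E inE => /andP[].
by rewrite -E finset.setDDr finset.setDv finset.set0U (finset.setIidPr et).
Qed.

(* That is, two triangles with a common edge lie on opposite sides of it. *)
Lemma opposite_sides e t t' a a' b b' : t \in T -> t' \in T -> t != t' ->
  #|e| = 2%N -> a \in t -> a' \in t' -> e = (t :\ a)%SET -> e = (t' :\ a')%SET ->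
  barycentric pos t b -> barycentric pos t' b' ->
  b' a' (pos a) < 0 /\ forall q, b' a' q = b a q * b' a' (pos a).
Proof.
move=> tT tT' tt' e2 at_ at' Et Et' bP bP'.
have [bc b1 bq] := bP; have [_ b1' bq'] := bP'.
have et' : e \subset t' by rewrite Et' subD1set.
have E q : b' a' q = b a q * b' a' (pos a).
  (* Expanding [q] over [t] and each vertex of [t] over [t']: the coordinate [b' a'] vanishes on
     [e], so only the term of [a] survives. *)
  rewrite (barycentric_unique (w := fun v => \sum_(u in t) b u q * b' v (pos u)) (indT tT') bP') //.
  - rewrite (bigD1 a) //= big1 ?addr0 // => u /andP[ut ua].
    have ue : u \in e by rewrite Et !inE ua.
    rewrite (barycentric_vertex (indT tT') bP' at' (fintype.subsetP et' _ ue)).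
    by move: ue; rewrite Et' !inE eq_sym => /andP[/negPf-> _]; rewrite mulr0.
  - rewrite exchange_big /= -[RHS](b1 q); apply: eq_bigr => u _.
    by rewrite -big_distrr /= b1' mulr1.
  - rewrite {1}(bq q); transitivity (\sum_(u in t) \sum_(v in t') (b u q * b' v (pos u)) *: pos v).
      apply: eq_bigr => u _; rewrite {1}(bq' (pos u)) scaler_sumr.
      by apply: eq_bigr => v _; rewrite scalerA.
    by rewrite exchange_big /=; apply: eq_bigr => v _; rewrite scaler_suml.
(* Otherwise a point slightly off the midpoint of [e] towards [pos a] would lie in the open triangle
   [t] and in [t'], forcing [t = t']. *)
split=> //; rewrite ltNge; apply/negP => pos_side.
have e0 : e != finset.set0 by rewrite -card_gt0 e2.
pose m := barycenter pos e.
have me : open_hull pos e m by exact: barycenter_open_hull.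
have me1 : open_hull pos (t :\ a)%SET m by rewrite -Et.
have me2 : open_hull pos (t' :\ a')%SET m by rewrite -Et'.
have near1 := facet_near (indT tT) bP at_ me1.
have near2 := facet_near (indT tT') bP' at' me2.
have [k k0 kP] := nbhs_line (pos a - m) (filterI near1 near2).
have bam : b a m = 0.
  by apply: (barycentric_facet (indT tT) bP at_); apply: open_hull_hull.
have [] := kP (k / 2); first by rewrite gtr0_norm; lra.
set q := m + _.
have bq0 : 0 < b a q.
  rewrite /q (barycentric_affine (indT tT) bP) // bam subrKC.
  by rewrite (barycentric_vertex (indT tT) bP) // eqxx subr0 add0r mulr1 divr_gt0.
move=> [_ /(_ bq0) tq] [+ _]; rewrite E => /(_ _) tq'.
have /tq' {}tq' : 0 <= b a q * b' a' (pos a) by rewrite mulr_ge0 // ltW.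
have st := open_hull_sub_face tT (fintype.subxx t) tT' (fintype.subxx t') tq tq'.
by move: tt'; rewrite finset.eqEcard st !card_T.
Qed.

(** With three triangles on [e], the coordinate of [pos a1] in the third would be negative and also
    a product of two negative numbers. *)
Lemma face_card_cofaces F e : F \subset T -> e \in edges F -> (#|cofaces F e| <= 2)%N.
Proof.
move=> /fintype.subsetP sF /edgesP[e2 _]; rewrite leqNgt; apply/negP.
move=> /card_gt2P[t1 [t2 [t3 [[h1 h2 h3] [t12 t23 t31]]]]].
move: h1 h2 h3; rewrite !inE => /andP[/sF T1 e1] /andP[/sF T2 e2'] /andP[/sF T3 e3].
have [a1 a1t E1] := apex T1 e1 e2; have [a2 a2t E2] := apex T2 e2' e2.
have [a3 a3t E3] := apex T3 e3 e2.
have [b1 P1] := face_coordinates T1; have [b2 P2] := face_coordinates T2.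
have [b3 P3] := face_coordinates T3.
have [n12 p12] := opposite_sides T1 T2 t12 e2 a1t a2t E1 E2 P1 P2.
have [n23 p23] := opposite_sides T2 T3 t23 e2 a2t a3t E2 E3 P2 P3.
have t13 : t1 != t3 by rewrite eq_sym.
have [n13 p13] := opposite_sides T1 T3 t13 e2 a1t a3t E1 E3 P1 P3.
have := p23 (pos a1); nra.
Qed.

Lemma nbhs_open_face F t x : t \in T -> t \in F -> open_hull pos t x -> nbhs x (carrier pos F).
Proof.
move=> tT tF tx; have [b bP] := face_coordinates tT.
apply: filterS (open_hull_near (indT tT) bP tx) => q tq.
by exists t => //; exact: open_hull_hull.
Qed.

Lemma nbhs_open_edge F e t x : F \subset T -> t \in F -> e \subset t -> #|e| = 2%N ->
  e \notin rim F -> open_hull pos e x -> nbhs x (carrier pos F).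
Proof.
move=> sF tF et e2 er ex; have eE : e \in edges F by apply/edgesP; split=> //; exists t.
have [[]|[_ [t1 [t2 [t12 E]]]]] := cofacesP (fun e' => @face_card_cofaces F e' sF) eE.
  by rewrite (negPf er).
have : t1 \in cofaces F e by rewrite E !inE eqxx.
have : t2 \in cofaces F e by rewrite E !inE eqxx orbT.
rewrite !inE => /andP[F2 e2'] /andP[F1 e1].
have T1 := fintype.subsetP sF _ F1; have T2 := fintype.subsetP sF _ F2.
have [a1 a1t E1] := apex T1 e1 e2; have [a2 a2t E2] := apex T2 e2' e2.
have [b1 P1] := face_coordinates T1; have [b2 P2] := face_coordinates T2.
have [n12 p12] := opposite_sides T1 T2 t12 e2 a1t a2t E1 E2 P1 P2.
have x1 : open_hull pos (t1 :\ a1)%SET x by rewrite -E1.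
have x2 : open_hull pos (t2 :\ a2)%SET x by rewrite -E2.
have near1 := facet_near (indT T1) P1 a1t x1.
have near2 := facet_near (indT T2) P2 a2t x2.
apply: filterS (filterI near1 near2) => q [[q1 _] [q2 _]].
have [b1q|b1q] := leP 0 (b1 a1 q); first by exists t1 => //; exact: q1.
exists t2 => //; apply: q2; rewrite p12; nra.
Qed.

(** The coordinates of [i] and [j] vanish at [pos v]. A segment through [pos v] would make those of
    [p] and [q] proportional, which [cross] excludes unless [b i q = 0]; in that case the vertex
    could only be reached at [k = 1], that is at [q]. *)
Lemma segment_avoids_vertex v q p b t i j : t \in T -> v \in t ->
  barycentric pos t b -> open_hull pos t p -> q != pos v ->
  i \in t -> j \in t -> i != v -> j != v ->
  (b i q == 0) || (b i q * b j p != b j q * b i p) ->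
  forall k : R, 0 <= k <= 1 -> p + k *: (q - p) != pos v.
Proof.
move=> tT vt bP tp qv it jt iv jv cross k k01; apply/eqP => E.
have bE u : u \in t -> u != v -> b u p + k * (b u q - b u p) = 0.
  move=> ut uv; have := barycentric_affine (indT tT) bP p (q - p) k ut.
  rewrite E [p + (q - p)]addrC subrK => <-.
  by rewrite (barycentric_vertex (indT tT) bP) // (negPf uv).
have bp0 : b i p != 0.
  by apply: lt0r_neq0; exact: ((open_hullP (indT tT) bP p).1 tp).
have k0 : k != 0.
  by apply: contraNneq bp0 => k0; have := bE i it iv; rewrite k0 mul0r addr0 => /eqP.
have /orP[/eqP biq|/eqP] := cross; last first.
  apply; apply: (mulfI k0); apply/eqP; rewrite -subr_eq0.
  have -> : k * (b i q * b j p) - k * (b j q * b i p) =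
      (b i p + k * (b i q - b i p)) * b j p - (b j p + k * (b j q - b j p)) * b i p.
    by ring.
  by rewrite !bE // !mul0r subrr.
have : b i p * (1 - k) = 0 by rewrite -(bE i it iv) biq; ring.
move=> /eqP; rewrite mulf_eq0 (negPf bp0) subr_eq0 => /eqP k1.
by move: E; rewrite -k1 scale1r subrKC; apply/eqP.
Qed.

Lemma generic_direction t b i j q : t \in T -> barycentric pos t b ->
  i \in t -> j \in t -> i != j ->
  exists2 m, open_hull pos t m &
    (b i q == 0) || (b i q * b j m != b j q * b i m).
Proof.
move=> tT bP it jt ij; pose m := barycenter pos t.
have tm : open_hull pos t m.
  by apply: barycenter_open_hull; rewrite -card_gt0 card_T.
have [/orP h|] := boolP ((b i q == 0) || (b i q * b j m != b j q * b i m)).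
  by exists m => //; apply/orP.
rewrite negb_or negbK => /andP[biq /eqP E].
(* The barycenter fails only if it is proportional to [q] in these coordinates; moving it halfway
   towards [pos i] changes the ratio of its two coordinates. *)
exists (m + 2^-1 *: (pos i - m)).
  by apply: open_hull_convex => //; [exact: hull_vertex|lra].
apply/orP; right; rewrite !(barycentric_affine (indT tT) bP) // subrKC.
rewrite !(barycentric_vertex (indT tT) bP) // eqxx [j == i]eq_sym (negPf ij) /=.
have bm u : u \in t -> 0 < b u m by exact: ((open_hullP (indT tT) bP m).1 tm).
apply/eqP => E'; have bjq : b j q = 0 by move: E E'; rewrite mulr1n mulr0n; nra.
move: E; rewrite bjq mul0r => /eqP; rewrite mulf_eq0 (negPf biq) /=.
by rewrite gt_eqF // bm.
Qed.

(* Near [pos v] every point of the carrier other than [pos v] is interior to it,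
   so the carrier is clopen in each short segment avoiding [pos v]; any nearby
   [q] is joined by such a segment to an interior point of the triangle [t]. *)
Lemma nbhs_vertex F v t : F \subset T -> t \in F -> v \in t ->
  (forall e, e \in rim F -> v \notin e) -> nbhs (pos v) (carrier pos F).
Proof.
move=> sF tF vt vrim; have tT := fintype.subsetP sF _ tF.
have := hull_away_near (pos v) => /nbhs_ballP[r /= r0 away].
have inner q : ball (pos v) r q -> q != pos v -> carrier pos F q ->
    nbhs q (carrier pos F).
  move=> /away {}away qv [t' tF' /hull_open_hull[s st' sq]].
  have tT' := fintype.subsetP sF _ tF'.
  have vs : v \in s.
    apply: contrapT => vs; apply: (away s t' tT' st' _ (open_hull_hull sq)).
    by move=> /(vertex_in_face tT' st').
  have : (0 < #|s| <= 3)%N.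
    by rewrite -(card_T tT') subset_leq_card // andbT; apply/card_gt0P; exists v.
  case E : #|s| => [|[|[|[|//]]]] // _.
  - have /eqP s1 : [set v]%SET == s by rewrite finset.eqEcard E cards1 finset.sub1set vs.
    move: sq; rewrite -s1 => -[w [_]]; rewrite !big_set1 => ->; rewrite scale1r.
    by move=> qE; rewrite qE eqxx in qv.
  - apply: (nbhs_open_edge sF tF' st' E _ sq).
    by apply/negP => /vrim; rewrite vs.
  - have /eqP sE : s == t' by rewrite finset.eqEcard st' E card_T.
    by apply: (nbhs_open_face tT' tF'); rewrite -sE.
apply/nbhs_ballP; exists r => // q vq.
have [->|qv] := eqVneq q (pos v); first by exists t => //; exact: hull_vertex.
have [b bP] := face_coordinates tT.
have /cards2P[i [j [ij E]]] : #|(t :\ v)%SET| == 2%N.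
  by have := cardsD1 v t; rewrite vt card_T // add1n => -[<-].
have /setD1P[iv it] : i \in (t :\ v)%SET by rewrite E !inE eqxx.
have /setD1P[jv jt] : j \in (t :\ v)%SET by rewrite E !inE eqxx orbT.
have [m tm cross] := generic_direction q tT bP it jt ij.
have [k k0 kP] := nbhs_line (m - pos v) (nbhsx_ballx (pos v) r r0).
(* Below [k], to keep [p] in the ball, and at most 1, to keep it in the open triangle. The factor
   [c] scales both coordinates of [m] and so preserves [cross]. *)
pose c := Num.min (k / 2) 2^-1.
have c0 : 0 < c by rewrite lt_min; apply/andP; split; lra.
have c1 : c <= 2^-1 by rewrite ge_min lexx orbT.
have ck : c < k by rewrite gt_min; apply/orP; left; lra.
pose p := pos v + c *: (m - pos v).
have vp : ball (pos v) r p by apply: kP; rewrite gtr0_norm.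
have tp : open_hull pos t p.
  have -> : p = m + (1 - c) *: (pos v - m).
    by apply/rowP => n; rewrite !mxE; ring.
  by apply: open_hull_convex => //; [exact: hull_vertex|lra].
have bp u : u \in t -> u != v -> b u p = c * b u m.
  move=> ut uv; rewrite (barycentric_affine (indT tT) bP) // subrKC.
  by rewrite (barycentric_vertex (indT tT) bP) // (negPf uv) add0r subr0.
have cross' : (b i q == 0) || (b i q * b j p != b j q * b i p).
  rewrite !bp //; case/orP: cross => [->//|h]; apply/orP; right.
  by rewrite !(mulrCA _ c) (inj_eq (mulfI _)) // gt_eqF.
apply: (@segment_clopen _ _ p q (carrier_closed sF)).
  by exists t => //; exact: open_hull_hull.
move=> s s01; apply: inner; last first.
  exact: (segment_avoids_vertex tT vt bP tp qv it jt iv jv cross').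
move: vp vq; rewrite -!ball_normE /ball_ /= => vp vq.
have -> : pos v - (p + s *: (q - p)) = (1 - s) *: (pos v - p) + s *: (pos v - q).
  by apply/rowP => n; rewrite !mxE; ring.
rewrite (le_lt_trans (ler_normD _ _)) // !normrZ.
have /andP[s0 s1] := s01; rewrite [`|1 - s|]ger0_norm ?subr_ge0 // [`|s|]ger0_norm //.
set n1 := `|pos v - p| in vp *; set n2 := `|pos v - q| in vq *.
have [h|h] := leP n1 n2; nra.
Qed.

Lemma carrier_interior F x : F \subset T -> carrier pos F x ->
  (forall e, e \in rim F -> ~ hull pos e x) -> nbhs x (carrier pos F).
Proof.
move=> sF [t tF /hull_open_hull[s st sx]] xrim.
have tT := fintype.subsetP sF _ tF.
have : (0 < #|s| <= 3)%N.
  rewrite -(card_T tT) subset_leq_card // andbT lt0n cards_eq0.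
  by apply/eqP => s0; apply: (@hull0 R V pos x); rewrite -s0; exact: open_hull_hull.
case E : #|s| => [|[|[|[|//]]]] // _.
- have /eqP/cards1P[v sE] := E; subst s.
  have -> : x = pos v by case: sx => w [_]; rewrite !big_set1 => -> ->; rewrite scale1r.
  apply: (nbhs_vertex sF tF); first by rewrite -finset.sub1set.
  move=> e er; apply/negP => ve; apply: (xrim e er).
  by apply: hull_subset (open_hull_hull sx); rewrite finset.sub1set.
- apply: (nbhs_open_edge sF tF st E _ sx).
  by apply/negP => er; apply: (xrim s er); exact: open_hull_hull.
- have /eqP sE : s == t by rewrite finset.eqEcard st E card_T.
  by apply: (nbhs_open_face tT tF); rewrite -sE.
Qed.

Lemma face_rim_neq0 F : F \subset T -> F != finset.set0 -> exists e, e \in rim F.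
Proof.
move=> sF F0; have [t0 tF0] := set0Pn _ F0.
apply: contrapT => norim.
have [v0 vt0] : exists v, v \in t0.
  by apply/card_gt0P; rewrite card_T // (fintype.subsetP sF).
have vF0 : v0 \in finset.cover F by apply/bigcupP; exists t0.
have [v /bigcupP[t tF vt] vmax] := arg_maxP (fun v => pos v 0 0) vF0.
have /(nbhs_line (delta_mx 0 0)) : nbhs (pos v) (carrier pos F).
  by apply: (nbhs_vertex sF tF vt) => e er; case: norim; exists e.
move=> [k k0 /(_ (k / 2))] [|s sF' [w [w0 w1]]]; first by rewrite gtr0_norm; lra.
move=> /rowP/(_ 0); rewrite summxE !mxE /= mulr1.
rewrite (eq_bigr (fun u => w u * pos u 0 0)) => [E|u _]; last by rewrite mxE.
have : \sum_(u in s) w u * pos u 0 0 <= \sum_(u in s) w u * pos v 0 0.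
  apply: ler_sum => u us; apply: ler_wpM2l; first exact: w0.
  by apply: vmax; apply/bigcupP; exists s.
rewrite -big_distrl /= w1 mul1r.
rewrite -E; lra.
Qed.

(** Leaving the only coface of [e] across the open edge leads out of the carrier: close to [x] every
    face also contains [x], hence [e], and would be a second coface. An endpoint of [e] has points
    of the open edge arbitrarily near. *)
Lemma rim_not_interior F e x : F \subset T -> e \in rim F -> hull pos e x ->
  ~ nbhs x (carrier pos F).
Proof.
move=> sF er; wlog ex : x / open_hull pos e x => [open_case ex xF|_].
  have e0 : e != finset.set0.
    by move: er; rewrite inE -card_gt0 => /andP[/eqP-> _].
  have me := barycenter_open_hull pos e0; set m := barycenter pos e in me.
  have [k k0 kP] := nbhs_line (m - x) (nbhs_interior xF).
  pose c := Num.min (k / 2) 1.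
  have c0 : 0 < c by rewrite lt_min; apply/andP; split; lra.
  have c1 : c <= 1 by rewrite ge_min lexx orbT.
  have ck : c < k by rewrite gt_min; apply/orP; left; lra.
  have cx : open_hull pos e (x + c *: (m - x)).
    have -> : x + c *: (m - x) = m + (1 - c) *: (x - m).
      by apply/rowP => n; rewrite !mxE; ring.
    by apply: open_hull_convex => //; lra.
  by apply: (open_case _ cx (open_hull_hull cx)); apply: kP; rewrite gtr0_norm.
have /andP[/eqP e2 /cards1P[t E]] : (#|e| == 2%N) && (#|cofaces F e| == 1%N).
  by rewrite inE in er.
have := set11 t; rewrite -E inE => /andP[tF et] xF.
have tT := fintype.subsetP sF _ tF.
have [a at_ Et] := apex tT et e2; have [b bP] := face_coordinates tT.
have bax : b a x = 0.
  by apply: (barycentric_facet (indT tT) bP at_); rewrite -Et; exact: open_hull_hull.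
have [k k0 kP] := nbhs_line (pos a - x) (filterI xF (hull_away_near x)).
have [] := kP (- (k / 2)); first by rewrite normrN gtr0_norm; lra.
set y := x + _ => -[t' tF' ty'] away.
have tT' := fintype.subsetP sF _ tF'.
have [tt'|tt'] := eqVneq t' t.
  move: ty'; rewrite tt' => /(hullP (indT tT) bP y (fintype.subxx t)) /(_ a at_).
  rewrite at_ /y (barycentric_affine (indT tT) bP) // subrKC bax.
  by rewrite (barycentric_vertex (indT tT) bP) // eqxx mulr1n; lra.
apply: (away t' t' tT' (fintype.subxx t') _ ty') => tx'.
have et' := open_hull_sub_face tT et tT' (fintype.subxx t') ex tx'.
have : t' \in cofaces F e by rewrite inE tF'.
by rewrite E inE (negPf tt').
Qed.

(** Identifies [gamma] with the union of the rim edges; this is where the topological boundary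
    becomes combinatorial. *)
Lemma carrier_frontier F : F \subset T ->
  closure (carrier pos F) `\` (carrier pos F)° = carrier pos (rim F).
Proof.
move=> sF; have <- := (closure_id _).1 (carrier_closed sF).
apply/seteqP; split=> x.
  move=> [Fx nx]; apply: contrapT => nrim; apply: nx.
  by apply: (carrier_interior sF Fx) => e er ex; apply: nrim; exists e.
move=> [e er ex]; split; last exact: (rim_not_interior sF er ex).
have /edgesP[_ [t tF et]] := fintype.subsetP (rim_edges F) _ er.
by exists t => //; exact: hull_subset et _ ex.
Qed.

End Triangulated.

(** * Ray parity *)

Section RayParity.
Variables (R : realType) (c : R).
Implicit Types (x y : R) (u v p q : 'rV[R]_2).

(** A shear: the vertical lines of the argument are those along which this form is constant. The
    coefficient [c] is chosen so that no two vertices share such a line. *)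
Definition abscissa p : R := p 0 0 + c * p 0 1.
Definition ordinate p : R := p 0 1.

Lemma abscissa_line p d (k : R) : abscissa (p + k *: d) = abscissa p + k * abscissa d.
Proof. by rewrite /abscissa !mxE; ring. Qed.

Lemma abscissaB p q : abscissa (p - q) = abscissa p - abscissa q.
Proof. by rewrite /abscissa !mxE; ring. Qed.

Lemma coordinates_inj p q : abscissa p = abscissa q -> ordinate p = ordinate q -> p = q.
Proof.
rewrite /abscissa /ordinate => h0 h1; apply: rV2_eq => //.
by move: h0; rewrite h1 => /addIr.
Qed.

Definition height u v x : R :=
  ordinate u + (ordinate v - ordinate u) * ((x - abscissa u) / (abscissa v - abscissa u)).

(** Whether the upward ray from [p] meets the edge. A ray through a vertex counts only the edges
    going right from it. *)
Definition under_edge u v p : bool :=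
  (abscissa u <= abscissa p < abscissa v) && (ordinate p < height u v (abscissa p)).

(** Half-open at the other end than [under_edge], so that in both a vertex on the vertical line of
    [p] or [q] counts as lying to the left of that point. *)
Definition above_segment p q u : bool :=
  (abscissa p < abscissa u <= abscissa q) && (height p q (abscissa u) < ordinate u).

Lemma height_left u v : height u v (abscissa u) = ordinate u.
Proof. by rewrite /height subrr mul0r mulr0 addr0. Qed.

Lemma height_right u v : abscissa u < abscissa v -> height u v (abscissa v) = ordinate v.
Proof. by move=> uv; rewrite /height divff ?mulr1 ?subrKC // subr_eq0 gt_eqF. Qed.

Lemma height_point u v x : abscissa u < abscissa v -> abscissa u <= x <= abscissa v ->
  exists2 k : R, 0 <= k <= 1 & abscissa (u + k *: (v - u)) = x /\
    ordinate (u + k *: (v - u)) = height u v x.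
Proof.
move=> uv xuv; have d0 : 0 < abscissa v - abscissa u by rewrite subr_gt0.
exists ((x - abscissa u) / (abscissa v - abscissa u)).
  rewrite ler_pdivlMr // ler_pdivrMr //; lra.
rewrite abscissa_line abscissaB divfK ?gt_eqF // subrKC; split=> //.
by rewrite /height /ordinate !mxE; ring.
Qed.

Definition disjoint_segments u v p q := forall k l : R, 0 <= k <= 1 -> 0 <= l <= 1 ->
  u + k *: (v - u) <> p + l *: (q - p).

Section SameSide.
Variables u v p q : 'rV[R]_2.
Hypothesis disj : disjoint_segments u v p q.
Hypothesis uv : abscissa u < abscissa v.

Lemma vertical_same_side : abscissa p = abscissa q ->
  under_edge u v p = under_edge u v q.
Proof.
move=> pq; rewrite /under_edge -pq; case: (boolP (_ <= _ < _)) => //= /andP[up pv].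
have [|k k01 [kx ky]] := @height_point u v (abscissa p) uv; first by rewrite up ltW.
set h := height u v _ in ky *.
have no (l : R) : 0 <= l <= 1 -> ordinate p + l * (ordinate q - ordinate p) <> h.
  move=> l01 E; apply: (disj k01 l01); apply: coordinates_inj.
    by rewrite kx abscissa_line abscissaB pq subrr mulr0 addr0.
  by rewrite ky -E /ordinate !mxE.
have strict (y y' : R) : y < h -> h <= y' ->
    exists2 l : R, 0 <= l <= 1 & y + l * (y' - y) = h.
  move=> yh hy'; have d0 : 0 < y' - y by lra.
  exists ((h - y) / (y' - y)); first by rewrite ler_pdivlMr // ler_pdivrMr //; lra.
  by rewrite divfK ?gt_eqF // subrKC.
have [ph|hp] := ltP (ordinate p) h; have [qh|hq] := ltP (ordinate q) h => //.
  by have [l l01 /(no l l01)] := strict _ _ ph hq.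
have [l l01 E] := strict _ _ qh hp; case: (no (1 - l)); first by lra.
by rewrite -E; ring.
Qed.

Hypothesis pq : abscissa p < abscissa q.

Lemma height_same_side x y :
  abscissa u <= x <= abscissa v -> abscissa p <= x <= abscissa q ->
  abscissa u <= y <= abscissa v -> abscissa p <= y <= abscissa q ->
  (height p q x < height u v x) = (height p q y < height u v y).
Proof.
wlog suff : x y / abscissa u <= x <= abscissa v -> abscissa p <= x <= abscissa q ->
  abscissa u <= y <= abscissa v -> abscissa p <= y <= abscissa q ->
  height p q x < height u v x -> height p q y < height u v y.
  by move=> one_way *; apply/idP/idP; apply: one_way.
move=> xuv xpq yuv ypq fx; rewrite ltNge; apply/negP => fy.
pose f z := height u v z - height p q z.
have d0 : 0 < f x - f y by rewrite /f; lra.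
(* The zero of the difference of heights, which is affine and positive at [x] but not at [y]; the
   segments would meet there. *)
pose l := f x / (f x - f y).
have l01 : 0 <= l <= 1 by rewrite ler_pdivlMr // ler_pdivrMr // /f; lra.
pose z := x + l * (y - x).
have zuv : abscissa u <= z <= abscissa v by rewrite /z; nra.
have zpq : abscissa p <= z <= abscissa q by rewrite /z; nra.
have fz : height u v z = height p q z.
  apply/eqP; rewrite -subr_eq0; apply/eqP.
  have hz a b : height a b z = height a b x + l * (height a b y - height a b x).
    by rewrite /height /z; ring.
  rewrite !hz; transitivity (f x - l * (f x - f y)); first by rewrite /f; ring.
  by rewrite /l divfK ?gt_eqF // subrr.
have [k k01 [kx ky]] := height_point uv zuv.
have [k' k01' [kx' ky']] := height_point pq zpq.
by apply: (disj k01 k01'); apply: coordinates_inj; rewrite ?kx ?ky ?kx' ?ky'.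
Qed.

(* The vertical rays above p and q and the segment pq bound a region; if uv
   does not meet pq it meets the boundary of this region in the two rays only,
   hence evenly or oddly often according to where its ends are. *)
Lemma no_crossing : under_edge u v p (+) under_edge u v q =
  above_segment p q u (+) above_segment p q v.
Proof.
pose G x := height p q x < height u v x.
have -> : under_edge u v p = (abscissa u <= abscissa p < abscissa v) && G (abscissa p).
  by rewrite /G height_left.
have -> : under_edge u v q = (abscissa u <= abscissa q < abscissa v) && G (abscissa q).
  by rewrite /G height_right.
have -> : above_segment p q u = (abscissa p < abscissa u <= abscissa q) && G (abscissa u).
  by rewrite /G height_left.
have -> : above_segment p q v = (abscissa p < abscissa v <= abscissa q) && G (abscissa v).
  by rewrite /G height_right.
have h1 := uv; have h2 := pq.
case: (leP (abscissa u) (abscissa p)) => h3; case: (ltP (abscissa p) (abscissa v)) => h4;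
case: (leP (abscissa u) (abscissa q)) => h5; case: (ltP (abscissa q) (abscissa v)) => h6;
  rewrite /= ?addbF ?addFb //; try (exfalso; lra).
- by rewrite /G (@height_same_side (abscissa p) (abscissa q)) ?addbb //; lra.
- by rewrite /G (@height_same_side (abscissa p) (abscissa v)) //; lra.
- by rewrite /G (@height_same_side (abscissa q) (abscissa u)) //; lra.
- by rewrite /G (@height_same_side (abscissa u) (abscissa v)) ?addbb //; lra.
Qed.

End SameSide.
End RayParity.

(** * A function on faces with prescribed jumps across edges *)

Section DualPotential.
Variables (R : realType) (V : finType) (pos : V -> 'rV[R]_2) (c : R).
Hypothesis generic : injective (abscissa c \o pos).
Implicit Types (e t : {set V}) (p q : 'rV[R]_2).

(** Summing over ordered pairs spares naming the left end: only the pair from left to right can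
    contribute. *)
Definition edge_parity e p : 'F_2 :=
  \sum_(u in e) \sum_(v in e) (under_edge c (pos u) (pos v) p)%:R.

Lemma hull2 u v (k : R) : u != v -> 0 <= k <= 1 ->
  hull pos [set u; v]%SET (pos u + k *: (pos v - pos u)).
Proof.
move=> uv k01; exists (fun z => if z == u then 1 - k else k); split.
- by move=> z _; case: ifP => _; lra.
- by rewrite big_setU1 ?inE //= big_set1 eqxx eq_sym (negPf uv) subrK.
- rewrite big_setU1 ?inE //= big_set1 eqxx eq_sym (negPf uv).
  by apply/rowP => n; rewrite !mxE; ring.
Qed.

Lemma edge_sorted e : #|e| = 2%N -> exists u v,
  [/\ u != v, e = [set u; v]%SET & abscissa c (pos u) < abscissa c (pos v)].
Proof.
move=> /eqP/cards2P[u [v [uv ->]]].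
have [h|h|/generic h] := ltgtP (abscissa c (pos u)) (abscissa c (pos v)).
- by exists u, v.
- by exists v, u; rewrite eq_sym finset.setUC.
- by rewrite h eqxx in uv.
Qed.

Lemma edge_parityE u v p : u != v -> abscissa c (pos u) < abscissa c (pos v) ->
  edge_parity [set u; v]%SET p = (under_edge c (pos u) (pos v) p)%:R.
Proof.
move=> uv h.
have no a b : abscissa c (pos b) <= abscissa c (pos a) ->
    under_edge c (pos a) (pos b) p = false.
  by move=> ba; apply/negP => /andP[/andP[h1 h2] _]; lra.
rewrite /edge_parity !(big_setU1, big_set1) ?inE //=.
by rewrite !(no u u, no v v, no v u) ?lexx ?ltW // addr0 add0r !addr0.
Qed.

Definition in_strip p q (u : V) : 'F_2 :=
  (above_segment c p q (pos u) (+) above_segment c q p (pos u))%:R.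

Lemma F2_natb (a b : bool) : (a (+) b)%:R = a%:R + b%:R :> 'F_2.
Proof. by case: a; case: b; rewrite ?addr0 ?add0r //= F2_addrr. Qed.

(** An additive form of [no_crossing]: the change is a sum of terms attached to the ends of [e], and
    such terms cancel over an even set of edges. *)
Lemma edge_parity_disjoint e p q : #|e| = 2%N ->
  (forall k : R, 0 <= k <= 1 -> ~ hull pos e (p + k *: (q - p))) ->
  edge_parity e p + edge_parity e q = \sum_(u in e) in_strip p q u.
Proof.
move=> /edge_sorted[u [v [uv -> xuv]]].
wlog pq : p q / abscissa c p <= abscissa c q => [sym|] disj.
  have [/sym->//|qp] := leP (abscissa c p) (abscissa c q).
  rewrite addrC sym ?ltW //; first by apply: eq_bigr => z _; rewrite /in_strip addbC.
  move=> k k01; have -> : q + k *: (p - q) = p + (1 - k) *: (q - p).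
    by apply/rowP => n; rewrite !mxE; ring.
  by apply: disj; lra.
have dj : disjoint_segments (pos u) (pos v) p q.
  by move=> k l k01 l01 E; apply: (disj l l01); rewrite -E; exact: hull2.
rewrite !edge_parityE // -F2_natb big_setU1 ?inE //= big_set1 /in_strip -F2_natb.
have no z : above_segment c q p (pos z) = false.
  by apply/negP => /andP[/andP[h1 h2] _]; lra.
rewrite !no !addbF; congr (nat_of_bool _)%:R.
have [h|h|h] := ltgtP (abscissa c p) (abscissa c q); last first.
- rewrite (vertical_same_side dj) // addbb.
  have no' z : above_segment c p q (pos z) = false.
    by apply/negP => /andP[/andP[h1 h2] _]; lra.
  by rewrite !no'.
- by exfalso; lra.
- exact: no_crossing.
Qed.

Variables (E : {set {set V}}) (z : {set V} -> 'F_2).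
Hypothesis card_E : forall e, e \in E -> #|e| = 2%N.
Hypothesis z_even : forall v, \sum_(e in E | v \in e) z e = 0.

Definition ray_parity p : 'F_2 := \sum_(e in E) z e * edge_parity e p.

Lemma ray_parity_disjoint p q :
  (forall e, e \in E -> forall k : R, 0 <= k <= 1 -> ~ hull pos e (p + k *: (q - p))) ->
  ray_parity p = ray_parity q.
Proof.
move=> disj; suff h : ray_parity p + ray_parity q = 0.
  by rewrite -[RHS]add0r -(F2_addrr (ray_parity p)) -addrA h addr0.
rewrite -big_split /= (eq_bigr (fun e => \sum_(u in e) z e * in_strip p q u)).
  rewrite (exchange_big_dep predT) //= big1 // => u _.
  by rewrite -big_distrl /= z_even mul0r.
by move=> e eE; rewrite -mulrDr edge_parity_disjoint ?card_E ?mulr_sumr //; exact: disj.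
Qed.

(** Between two points of one vertical line the strip is empty, so every edge but [e] keeps its own
    parity. *)
Lemma ray_parity_flip e p q : e \in E -> abscissa c p = abscissa c q ->
  (forall f, f \in E -> f != e ->
     forall k : R, 0 <= k <= 1 -> ~ hull pos f (p + k *: (q - p))) ->
  edge_parity e p + edge_parity e q = 1 -> ray_parity p + ray_parity q = z e.
Proof.
move=> eE pq disj flip; rewrite -big_split /= (bigD1 e) //= -mulrDr flip mulr1.
rewrite big1 ?addr0 // => f /andP[fE fe].
rewrite -mulrDr edge_parity_disjoint ?card_E //; last exact: disj.
rewrite big1 ?mulr0 // => u _; rewrite /in_strip.
have no p' q' : abscissa c p' = abscissa c q' -> above_segment c p' q' (pos u) = false.
  by move=> h; apply/negP => /andP[/andP[h1 h2] _]; lra.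
by rewrite !no.
Qed.

End DualPotential.

Lemma generic_abscissa (R : realType) (V : finType) (pos : V -> 'rV[R]_2) :
  injective pos -> exists c, injective (abscissa c \o pos).
Proof.
move=> pos_inj.
pose slope (u v : V) : R := (pos v 0 0 - pos u 0 0) / (pos u 0 1 - pos v 0 1).
(* Vertices [u] and [v] of different ordinates share an abscissa only for [c = slope u v]; this [c]
   exceeds all slopes. *)
exists (1 + \sum_u \sum_v `|slope u v|) => u v /=; rewrite /abscissa => E.
have [h1|h1] := eqVneq (pos u 0 1) (pos v 0 1).
  by apply: pos_inj; apply: rV2_eq => //; move: E; rewrite h1 => /addIr.
have : 1 + \sum_(a : V) \sum_(b : V) `|slope a b| = slope u v :> R.
  rewrite /slope; set s := 1 + _ in E *.
  have h2 : pos u 0 1 - pos v 0 1 != 0 by rewrite subr_eq0.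
  by apply: (mulIf h2); rewrite divfK //; lra.
have : (`|slope u v| : R) <= \sum_a \sum_b `|slope a b|.
  rewrite (bigD1 u) //= (bigD1 v) //= -addrA lerDl addr_ge0 // sumr_ge0 // => a _.
  by rewrite sumr_ge0.
move=> hS hE; have := le_trans (ler_norm (slope u v)) hS; rewrite -hE.
by rewrite leNgt ltrDr ltr01.
Qed.

Section Triangulated.
Variables (R : realType) (V : finType) (pos : V -> 'rV[R]_2) (T : {set {set V}}).
Hypothesis triT : triangulation pos T.
Implicit Types (e t : {set V}) (F : {set {set V}}) (p q : 'rV[R]_2).

Let indT t : t \in T -> affinely_independent pos t :=
  @triangulation_nondegenerate _ _ _ _ triT t.

(** The potential of a face is the ray parity at its barycenter. Parity is constant on open faces,
    so it may be compared at two points just below and just above the midpoint of [e], where only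
    [e] flips it. *)
Lemma face_dual_potential F (z : {set V} -> 'F_2) : F \subset T ->
  (forall v, \sum_(e in edges F | v \in e) z e = 0) ->
  exists w : {set V} -> 'F_2, forall e t t', e \in edges F ->
    t \in cofaces F e -> t' \in cofaces F e -> t != t' -> w t + w t' = z e.
Proof.
move=> sF z_even; have sFT := fintype.subsetP sF.
have [c generic] := generic_abscissa (triangulation_pos_inj triT).
have card_E e : e \in edges F -> #|e| = 2%N by move=> /edgesP[].
pose par := ray_parity pos c (edges F) z.
have par_face t p q : t \in T -> open_hull pos t p -> open_hull pos t q -> par p = par q.
  move=> tT tp tq; apply: (ray_parity_disjoint generic card_E z_even).
  move=> e /edgesP[e2 [t' tF' et']] k k01 ek.
  have tk : open_hull pos t (p + k *: (q - p)).
    have [k1|k1] := ltP k 1.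
      by apply: open_hull_convex => //; [exact: open_hull_hull|lra].
    by have -> : k = 1; [lra|rewrite scale1r subrKC].
  have := open_hull_sub_face triT tT (fintype.subxx t) (sFT _ tF') et' tk ek.
  by move=> /subset_leq_card; rewrite e2 (triangulation_card triT tT).
exists (fun t => par (barycenter pos t)) => e t t' eE.
rewrite !inE => /andP[tF et] /andP[tF' et'] tt'.
have tT := sFT _ tF; have tT' := sFT _ tF'; have e2 := card_E e eE.
have [a at_ Et] := apex triT tT et e2; have [a' at' Et'] := apex triT tT' et' e2.
have [b bP] := face_coordinates triT tT; have [b' bP'] := face_coordinates triT tT'.
have [neg prop] := opposite_sides triT tT tT' tt' e2 at_ at' Et Et' bP bP'.
have [u [v [uv Euv xuv]]] := edge_sorted generic e2.
pose m := barycenter pos e.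
have mE : m = 2^-1 *: (pos u + pos v).
  by rewrite /m /barycenter e2 Euv big_setU1 ?inE //= big_set1 scalerDr.
have em : open_hull pos e m.
  by apply: barycenter_open_hull; rewrite -card_gt0 e2.
(* The upward direction of the sheared coordinates. *)
pose n : 'rV[R]_2 := (- c) *: delta_mx 0 0 + delta_mx 0 1.
have n0 : n 0 0 = - c by rewrite !mxE /=; ring.
have n1 : n 0 1 = 1 by rewrite !mxE /=; ring.
have xn : abscissa c n = 0 by rewrite /abscissa n0 n1; ring.
have bam : b a m = 0.
  by apply: (barycentric_facet (indT tT) bP at_); rewrite -Et; exact: open_hull_hull.
(* The edge is not vertical: if [m + n] were on its line, equal abscissas would give [m + n = m]. *)
have slope_neq0 : b a (m + n) != 0.
  apply/eqP => ban; have [_ b1 bq] := bP.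
  have := b1 (m + n); rewrite (big_setD1 a at_) /= -Et Euv big_setU1 ?inE //= big_set1.
  have := bq (m + n); rewrite (big_setD1 a at_) /= -Et Euv big_setU1 ?inE //= big_set1.
  rewrite ban scale0r !add0r.
  set bu := b u _; set bv := b v _ => Emn buv.
  have hx : (bu - 2^-1) * (abscissa c (pos u) - abscissa c (pos v)) = 0.
    have := congr1 (abscissa c) Emn; rewrite -[n]scale1r abscissa_line xn mE.
    rewrite /abscissa !mxE => h; have buE : bu = 1 - bv by lra.
    by move: h; rewrite buE; lra.
  move: hx => /eqP; rewrite mulf_eq0 !subr_eq0 (lt_eqF xuv) orbF => /eqP hbu.
  have hbv : bv = 2^-1 by lra.
  have := congr1 (fun q : 'rV[R]_2 => q 0 1) Emn.
  by rewrite hbu hbv -scalerDr -mE mxE n1; lra.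
have near1 : \forall q \near m, (0 < b a q -> open_hull pos t q).
  have := facet_near (indT tT) bP at_; rewrite -Et => /(_ _ em).
  by apply: filterS => q [].
have near2 : \forall q \near m, (0 < b' a' q -> open_hull pos t' q).
  have := facet_near (indT tT') bP' at'; rewrite -Et' => /(_ _ em).
  by apply: filterS => q [].
have [k k0 kP] := nbhs_line n (filterI (filterI near1 near2) (hull_away_near triT m)).
pose p := m + (- (k / 2)) *: n; pose q := m + (k / 2) *: n.
have [|[tp t'p] _] := kP (- (k / 2)); first by rewrite normrN gtr0_norm; lra.
have [|[tq t'q] _] := kP (k / 2); first by rewrite gtr0_norm; lra.
rewrite -/p in tp t'p; rewrite -/q in tq t'q.
have bap : b a p = - (k / 2) * b a (m + n).
  by rewrite (barycentric_affine (indT tT) bP) // bam; ring.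
have baq : b a q = k / 2 * b a (m + n).
  by rewrite (barycentric_affine (indT tT) bP) // bam; ring.
have <- : par p + par q = z e.
  rewrite /par; apply: (ray_parity_flip generic z card_E) => //.
  - by rewrite /p /q !abscissa_line xn !mulr0.
  - move=> f fE fe l l01; have /edgesP[f2 [s sF' fs]] := fE.
    have -> : p + l *: (q - p) = m + ((2 * l - 1) * (k / 2)) *: n.
      by apply/rowP => i; rewrite !mxE; field.
    have [|_ away] := kP ((2 * l - 1) * (k / 2)).
      rewrite normrM [`|k / 2|]gtr0_norm; last by lra.
      have : `|2 * l - 1| <= 1 by rewrite ler_norml; lra.
      by nra.
    apply: (away f s (sFT _ sF') fs) => fm.
    have := open_hull_sub_face triT tT et (sFT _ sF') fs em fm => ef.
    by move: fe; rewrite eq_sym finset.eqEcard ef e2 f2.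
  - rewrite Euv !edge_parityE //.
    have xm d : abscissa c (m + d *: n) = (abscissa c (pos u) + abscissa c (pos v)) / 2.
      by rewrite abscissa_line xn mE /abscissa !mxE; field.
    have hm d : under_edge c (pos u) (pos v) (m + d *: n) = (d < 0).
      rewrite /under_edge xm.
      have -> /= : abscissa c (pos u) <= (abscissa c (pos u) + abscissa c (pos v)) / 2
          < abscissa c (pos v) by apply/andP; split; lra.
      have -> : height c (pos u) (pos v) ((abscissa c (pos u) + abscissa c (pos v)) / 2)
          = ordinate m.
        rewrite /height mE /ordinate !mxE; field.
        by rewrite subr_eq0 gt_eqF.
      rewrite /ordinate mxE [(d *: n) 0 1]mxE n1 mulr1 -[X in _ < X]addr0.
      by rewrite ltrD2l.
    by rewrite !hm oppr_lt0 divr_gt0 // ltNge ltW ?divr_gt0 // addr0.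
have c3 s : s \in T -> open_hull pos s (barycenter pos s).
  by move=> sT; apply: barycenter_open_hull; rewrite -card_gt0 (triangulation_card triT sT).
have k2 : 0 < k / 2 by rewrite divr_gt0.
(* The sign tells whether [t] lies below or above [e], hence which of [p] and [q] belongs to it. *)
have [neg_slope|pos_slope] := ltP (b a (m + n)) 0.
  have tp' : open_hull pos t p by apply: tp; rewrite bap nmulr_rgt0 // oppr_lt0.
  have tq' : open_hull pos t' q.
    by apply: t'q; rewrite prop baq nmulr_lgt0 // pmulr_rlt0.
  by rewrite (par_face t _ p tT (c3 _ tT) tp') (par_face t' _ q tT' (c3 _ tT') tq').
have {}pos_slope : 0 < b a (m + n) by rewrite lt0r slope_neq0.
have tq' : open_hull pos t q by apply: tq; rewrite baq mulr_gt0.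
have tp' : open_hull pos t' p.
  by apply: t'p; rewrite prop bap nmulr_lgt0 // nmulr_rlt0 // oppr_lt0.
by rewrite (par_face t _ q tT (c3 _ tT) tq') (par_face t' _ p tT' (c3 _ tT') tp') addrC.
Qed.

End Triangulated.

(** * The boundary curve *)

Section Boundary.
Variables (R : realType) (V : finType) (pos : V -> 'rV[R]_2) (T F : {set {set V}}).
Hypotheses (triT : triangulation pos T) (sF : F \subset T).
Hypothesis curve : simple_closed_curve (carrier pos (rim F)).
Implicit Types (e t s : {set V}) (B : {set {set V}}) (x : 'rV[R]_2).

Let rim_face e : e \in rim F -> #|e| = 2%N /\ exists2 t, t \in T & e \subset t.
Proof.
move=> /(fintype.subsetP (rim_edges F)) /edgesP[e2 [t tF et]].
by split=> //; exists t => //; apply: (fintype.subsetP sF).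
Qed.

Lemma rim_sub_hull e e' s x : e \in rim F -> e' \in rim F -> s \subset e ->
  open_hull pos s x -> hull pos e' x -> s \subset e'.
Proof.
move=> /rim_face[_ [t tT et]] /rim_face[_ [t' tT' et']] se.
exact: (open_hull_sub_face triT tT (fintype.subset_trans se et) tT' et').
Qed.

Lemma rim_carrier_closed B : B \subset rim F -> closed (carrier pos B).
Proof.
move=> /fintype.subsetP sB; apply: closed_bigcup; first exact: finite_finset.
move=> e /sB /rim_face[_ [t tT et]]; exact: face_hull_closed triT _ _ tT et.
Qed.

Lemma open_hull_neq0 s x : open_hull pos s x -> exists v, v \in s.
Proof.
move=> sx; apply/card_gt0P; rewrite lt0n cards_eq0; apply/eqP => s0.
by apply: (@hull0 R V pos x); rewrite -s0; exact: open_hull_hull.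
Qed.

Lemma rim_open_hull_vertex e v x : e \in rim F -> open_hull pos e x -> x <> pos v.
Proof.
move=> er ex xv; have /rim_face[e2 [t tT et]] := er.
have [t' tT' vt'] := triangulation_cover triT v.
have : e \subset [set v]%SET.
  apply: (open_hull_sub_face triT tT et tT' _ ex); first by rewrite finset.sub1set.
  by rewrite xv; apply: hull_vertex; rewrite inE.
by move=> /subset_leq_card; rewrite e2 cards1.
Qed.

Lemma rim_barycenter e : e \in rim F -> open_hull pos e (barycenter pos e).
Proof.
by move=> /rim_face[e2 _]; apply: barycenter_open_hull; rewrite -card_gt0 e2.
Qed.

Lemma rim_meet e e' x : e \in rim F -> e' \in rim F -> e != e' ->
  hull pos e x -> hull pos e' x -> exists2 v, (v \in e) && (v \in e') & x = pos v.
Proof.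
move=> er er' ee' /hull_open_hull[s se sx] ex'.
have se' := rim_sub_hull er er' se sx ex'.
have [e2 _] := rim_face er; have [e2' _] := rim_face er'.
have [v vs] := open_hull_neq0 sx.
have s1 : #|s| = 1%N.
  apply/eqP; rewrite eqn_leq; apply/andP; split; last by apply/card_gt0P; exists v.
  rewrite leqNgt; apply: contra ee' => s2.
  have /eqP sE : s == e by rewrite finset.eqEcard se e2.
  by rewrite -sE finset.eqEcard se' e2'.
exists v; first by rewrite (fintype.subsetP se) ?(fintype.subsetP se').
have /eqP/cards1P[u sE] := s1; move: vs sx; rewrite sE inE => /eqP->.
by move=> [w [_]]; rewrite !big_set1 => -> ->; rewrite scale1r.
Qed.

Lemma rim_connected B : B \subset rim F -> B != finset.set0 ->
  (forall e e' v, e \in B -> e' \in rim F -> v \in e -> v \in e' -> e' \in B) ->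
  B = rim F.
Proof.
move=> sB B0 Bcl; have /fintype.subsetP sBr := sB.
have disj x : carrier pos B x -> carrier pos (rim F :\: B)%SET x -> False.
  move=> [e eB ex] [e' /= + ex']; rewrite finset.in_setD => /andP[eB' er'].
  have ee' : e != e' by apply: contraNneq eB' => <-.
  have [v /andP[ve ve'] _] := rim_meet (sBr _ eB) er' ee' ex ex'.
  by rewrite (Bcl e e' v) in eB'.
have [c [cc c01 cinj cE]] := curve.
have conn : connected (carrier pos (rim F)).
  by rewrite cE; apply: connected_continuous_connected => //; exact: segment_connected.
have BE : carrier pos B = carrier pos (rim F).
  apply: conn.
  - have [e eB] := set0Pn _ B0; exists (barycenter pos e).
    by exists e => //; apply/open_hull_hull/rim_barycenter/sBr.
  - exists (~` carrier pos (rim F :\: B)%SET).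
      by apply: closed_openC; apply: rim_carrier_closed; exact: finset.subsetDl.
    apply/seteqP; split=> x.
      by move=> Bx; split; [exact: carrier_subset sB _ Bx|exact: disj].
    move=> [[e er ex] nx]; exists e => //=; apply: contrapT => /negP eB.
    by apply: nx; exists e => //=; rewrite finset.in_setD eB.
  - exists (carrier pos B); first exact: rim_carrier_closed.
    apply/seteqP; split=> x [] //.
    by move=> e eB ex; split; exists e => //; exact: sBr.
apply/eqP; rewrite finset.eqEsubset sB /=; apply/fintype.subsetP => e er.
apply: contrapT => /negP eB; apply: (disj (barycenter pos e)).
  by rewrite BE; exists e => //; apply/open_hull_hull/rim_barycenter.
by exists e; [rewrite /= finset.in_setD eB|apply/open_hull_hull/rim_barycenter].
Qed.

(** * Counting edges along the closed curve *)

Section Parametrization.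
Variable c : R -> 'rV[R]_2.
Hypotheses (c_cont : {within `[0, 1], continuous c}) (c_loop : c 0 = c 1).
Hypothesis c_inj : {in `[0, 1[ &, injective c}.
Hypothesis c_image : carrier pos (rim F) = c @` `[0, 1].

Lemma arc_in_edge (a b : R) e e' : 0 <= a -> a <= b -> b <= 1 ->
  e \in rim F -> e' \in rim F -> open_hull pos e (c a) -> open_hull pos e' (c b) ->
  (forall r v, a <= r <= b -> v \in finset.cover (rim F) -> c r <> pos v) -> e = e'.
Proof.
move=> a0 ab b1 er er' ea eb novertex.
have sub : (`[a, b]%classic : set R) `<=` `[0, 1]%classic.
  by move=> r /=; rewrite !in_itv /= => ?; lra.
have conn : connected (c @` `[a, b]).
  apply: connected_continuous_connected; first exact: segment_connected.
  exact: continuous_subspaceW sub c_cont.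
have only r e1 : a <= r <= b -> e1 \in rim F -> e1 != e -> hull pos e (c r) ->
    hull pos e1 (c r) -> False.
  move=> rab e1r e1e ex e1x; have [v /andP[_ ve] cv] := rim_meet e1r er e1e e1x ex.
  by apply: (novertex r v rab _ cv); apply/bigcupP; exists e.
have E : hull pos e `&` (c @` `[a, b]) = c @` `[a, b].
  apply: conn.
  - exists (c a); split; first exact: open_hull_hull.
    by exists a => //; rewrite /= in_itv /= lexx.
  - exists (~` carrier pos (rim F :\ e)%SET).
      by apply: closed_openC; apply: rim_carrier_closed; exact: finset.subD1set.
    apply/seteqP; split=> x [].
      move=> + [r + rx]; rewrite -rx /= in_itv /= => ex rab.
      split; first by exists r; rewrite //= in_itv.
      move=> [e1 /=]; rewrite finset.in_setD1 => /andP[e1e e1r] e1x.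
      exact: (only r e1 rab e1r e1e ex e1x).
    move=> [r rab <-] nx; split; last by exists r.
    have : carrier pos (rim F) (c r) by rewrite c_image; exists r => //; exact: sub.
    move=> [e1 /= e1r e1x]; have [<-//|e1e] := eqVneq e1 e.
    by case: nx; exists e1; rewrite //= finset.in_setD1 e1e.
  - exists (hull pos e); last by rewrite setIC.
    by have [_ [t tT et]] := rim_face er; exact: face_hull_closed triT _ _ tT et.
have [ex _] : (hull pos e `&` (c @` `[a, b])) (c b).
  by rewrite E; exists b => //; rewrite /= in_itv /= lexx ab.
have [e2 _] := rim_face er; have [e2' _] := rim_face er'.
have := rim_sub_hull er' er (fintype.subxx e') eb ex => ee.
by apply/esym/eqP; rewrite finset.eqEcard ee e2 e2'.
Qed.

Lemma curve_parameter x : carrier pos (rim F) x -> exists2 r : R, 0 <= r < 1 & c r = x.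
Proof.
rewrite c_image => -[r /=]; rewrite in_itv /= => r01 <-.
have [r1|r1] := ltP r 1; first by exists r => //; lra.
by exists 0; [lra|rewrite c_loop; congr c; lra].
Qed.

(* Walking along the curve, the edge containing c s is determined by how many
   vertices have been passed before s, modulo the number of vertices. *)
Lemma card_rim_le : (#|rim F| <= #|finset.cover (rim F)|)%N.
Proof.
set W := finset.cover (rim F).
(* [rho] and [sig] choose the parameters at which the curve passes the vertices and the midpoints of
   edges; the value 0 elsewhere is a dummy. *)
have [rho rhoP] : {rho : V -> R & forall v, v \in W -> 0 <= rho v < 1 /\ c (rho v) = pos v}.
  apply: (@choice V R (fun v r => v \in W -> 0 <= r < 1 /\ c r = pos v)) => v.
  have [/bigcupP[e er ve]|_] := boolP (v \in W); last by exists 0.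
  have [|r r01 cr] := @curve_parameter (pos v); last by exists r.
  by exists e => //; exact: hull_vertex.
have [sig sigP] : {sig : {set V} -> R & forall e, e \in rim F ->
    0 <= sig e < 1 /\ c (sig e) = barycenter pos e}.
  apply: (@choice _ R (fun e r => e \in rim F -> 0 <= r < 1 /\
    c r = barycenter pos e)) => e.
  have [er|_] := boolP (e \in rim F); last by exists 0.
  have [|r r01 cr] := @curve_parameter (barycenter pos e); last by exists r.
  by exists e => //; apply/open_hull_hull/rim_barycenter.
have rho_unique r v : 0 <= r < 1 -> v \in W -> c r = pos v -> r = rho v.
  move=> r01 vW cr; have [rv01 crv] := rhoP v vW.
  by apply: c_inj; rewrite ?in_itv //= crv.
have sig_open e : e \in rim F -> open_hull pos e (c (sig e)).
  by move=> er; have [_ ->] := sigP e er; exact: rim_barycenter.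
have rho_sig e v : e \in rim F -> v \in W -> rho v <> sig e.
  move=> er vW E; have [_ crv] := rhoP v vW.
  by apply: (rim_open_hull_vertex er (sig_open e er)); rewrite -E; exact: crv.
pose passed e := [set v in W | rho v < sig e]%SET.
have passedE e v : v \in W -> (v \in passed e) = (rho v < sig e).
  by move=> vW; rewrite inE vW.
have passed_sub e : passed e \subset W.
  by apply/fintype.subsetP => v; rewrite inE => /andP[].
have [W0|W_gt0] := posnP #|W|.
  rewrite W0 leqn0 cards_eq0; apply/eqP/finset.setP => e; rewrite [RHS]inE.
  apply/negP => er; have [e2 _] := rim_face er.
  have [v ve] : exists v, v \in e by apply/card_gt0P; rewrite e2.
  have : v \in W by apply/bigcupP; exists e.
  by move/cards0_eq : W0 => ->; rewrite inE.
(* The modulus identifies the edge left after the last vertex with the one on which the curve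
   starts. *)
pose f e : 'I_#|W| := Ordinal (ltn_pmod #|passed e| W_gt0).
suff f_inj : {in rim F &, injective f}.
  by rewrite -(card_in_imset f_inj) -[X in (_ <= X)%N]card_ord max_card.
move=> e e' er er' /(congr1 val) /=.
wlog ee' : e e' er er' / sig e <= sig e' => [sym|].
  by have [/sym|/ltW/sym] := leP (sig e) (sig e'); [exact|move=> h /esym /h ->].
have [se01 ce] := sigP e er; have [se01' ce'] := sigP e' er'.
have sub : passed e \subset passed e'.
  apply/fintype.subsetP => v; rewrite !inE => /andP[-> /= h]; exact: lt_le_trans h ee'.
have same : passed e = passed e' -> e = e'.
  move=> pp; apply: (@arc_in_edge (sig e) (sig e')) => //; try exact: sig_open; try lra.
  move=> r v rse vW cr; have rE : r = rho v by apply: rho_unique => //; lra.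
  have := passedE e v vW; rewrite pp passedE //.
  have := rho_sig e' v er' vW; lra.
have around : passed e = finset.set0 -> passed e' = W -> e = e'.
  move=> pe pe'.
  have before v : v \in W -> sig e < rho v.
    move=> vW; have := passedE e v vW; rewrite pe inE.
    have := rho_sig e v er vW; lra.
  have after v : v \in W -> rho v < sig e'.
    by move=> vW; rewrite -passedE // pe'.
  have start v r : 0 <= r <= sig e -> v \in W -> c r <> pos v.
    move=> r01 vW cr; have rE : r = rho v by apply: rho_unique => //; lra.
    by have := before v vW; lra.
  (* No vertex is passed before [sig e], so the base point is inside an edge [e1], which both the
     initial arc to [sig e] and the final arc from [sig e'] stay in. *)
  have c0 : carrier pos (rim F) (c 0) by rewrite c_image; exists 0; rewrite //= in_itv /=; lra.
  have [e1 /= e1r /hull_open_hull[s se1 s0]] := c0.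
  have [e12 _] := rim_face e1r.
  have s2 : s = e1.
    apply/eqP; rewrite finset.eqEcard se1 e12 ltnNge; apply/negP => s1.
    have [v vs] := open_hull_neq0 s0.
    have sE : [set v]%SET = s.
      by apply/eqP; rewrite finset.eqEcard finset.sub1set vs cards1.
    apply: (start v 0); first lra.
      by apply/bigcupP; exists e1 => //; rewrite (fintype.subsetP se1).
    by move: s0; rewrite -sE => -[w [_]]; rewrite !big_set1 => -> ->; rewrite scale1r.
  rewrite s2 in s0.
  have <- : e1 = e.
    apply: (@arc_in_edge 0 (sig e)) => //; try exact: sig_open; try lra.
    by move=> r v r01; exact: start.
  apply/esym; apply: (@arc_in_edge (sig e') 1); rewrite -?c_loop //; try exact: sig_open; try lra.
  move=> r v r01 vW cr; have [r1|r1] := ltP r 1.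
    have rE : r = rho v by apply: rho_unique => //; lra.
    by have := after v vW; lra.
  have rE : r = 1 by lra.
  by apply: (start v 0) => //; [lra|rewrite c_loop -rE].
have le1 := subset_leq_card sub; have le2 := subset_leq_card (passed_sub e').
have full s : (s \subset W) -> (#|W| <= #|s|)%N -> s = W.
  by move=> sW Ws; apply/eqP; rewrite finset.eqEcard sW.
have [lt'|ge'] := ltnP #|passed e'| #|W|.
  rewrite !modn_small ?(leq_ltn_trans le1) // => pp; apply: same.
  by apply/eqP; rewrite finset.eqEcard sub /= pp leqnn.
have pe' := full _ (passed_sub e') ge'; rewrite pe' modnn.
have [lt|ge] := ltnP #|passed e| #|W|.
  by rewrite modn_small // => /cards0_eq pe; exact: around.
by move=> _; apply: same; rewrite pe' (full _ (passed_sub e) ge).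
Qed.

End Parametrization.
Let card_cofaces e : e \in edges F -> (#|cofaces F e| <= 2)%N :=
  @face_card_cofaces _ _ _ _ triT F e sF.

Let card_F t : t \in F -> #|t| = 3%N.
Proof. by move=> /(fintype.subsetP sF); exact: triangulation_card triT t. Qed.

Lemma sum_rim_degrees : (\sum_(v in finset.cover (rim F))
  #|[set e in rim F | v \in e]%SET| = 2 * #|rim F|)%N.
Proof.
under eq_bigr do rewrite -sum1_card.
rewrite (exchange_big_dep (mem (rim F))) /=; last first.
  by move=> v e _; rewrite inE => /andP[].
rewrite mulnC -sum_nat_const; apply: eq_bigr => e er.
have [e2 _] := rim_face er; rewrite -[RHS]e2 -sum1_card; apply: eq_bigl => v.
rewrite finset.in_set er /=; have [ve|] := boolP (v \in e); rewrite ?andbF // andbT.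
by apply/bigcupP; exists e.
Qed.

Lemma rim_degree_ge2 v : v \in finset.cover (rim F) ->
  (2 <= #|[set e in rim F | v \in e]%SET|)%N.
Proof.
move=> /bigcupP[e er ve].
have := sum_rim_at card_F card_cofaces v; rewrite sumr_const.
rewrite (_ : #|_| = #|[set e in rim F | v \in e]%SET|); last first.
  by apply: eq_card => f; rewrite finset.in_set.
have : (0 < #|[set e in rim F | v \in e]%SET|)%N.
  by apply/card_gt0P; exists e; rewrite finset.in_set er.
by case: #|_| => [|[|n]].
Qed.

Lemma rim_regular : #|rim F| = #|finset.cover (rim F)| /\
  forall v, v \in finset.cover (rim F) -> #|[set e in rim F | v \in e]%SET| = 2%N.
Proof.
have [c [c_cont c_loop c_inj c_image]] := curve.
have le := card_rim_le c_cont c_loop c_inj c_image.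
have lower : (2 * #|finset.cover (rim F)| <= 2 * #|rim F|)%N.
  by rewrite -sum_rim_degrees mulnC -sum_nat_const; apply: leq_sum; exact: rim_degree_ge2.
have E : #|rim F| = #|finset.cover (rim F)|.
  by apply/eqP; rewrite eqn_leq le; move: lower; rewrite leq_pmul2l.
split=> // v vW; have := sum_rim_degrees.
rewrite E mulnC -sum_nat_const => /esym/eqP.
(* The degrees are at least 2 and add up to twice their number, so each bound is attained. *)
rewrite (leqif_sum (fun u uW => leqif_eq (rim_degree_ge2 uW))).
by move=> /forall_inP /(_ v vW) /eqP.
Qed.

(** At a vertex of degree 2 evenness makes the values on its two edges equal, so the edges of value
    1 are closed under adjacency and [rim_connected] applies. *)
Lemma rim_even_constant (z : {set V} -> 'F_2) :
  (forall v, \sum_(e in rim F | v \in e) z e = 0) ->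
  (forall e, e \in rim F -> z e = 0) \/ (forall e, e \in rim F -> z e = 1).
Proof.
move=> z_even.
have adjacent e e' v : e \in rim F -> e' \in rim F -> v \in e -> v \in e' -> z e = z e'.
  move=> er er' ve ve'; have [->//|ee'] := eqVneq e e'.
  have vW : v \in finset.cover (rim F) by apply/bigcupP; exists e.
  have E : [set e; e']%SET = [set e in rim F | v \in e]%SET.
    apply/eqP; rewrite finset.eqEcard rim_regular.2 // cards2 ee' andbT.
    by apply/fintype.subsetP => f; rewrite finset.in_set2 finset.in_set => /orP[] /eqP->; apply/andP.
  have := z_even v; rewrite (eq_bigl (fun f => f \in [set e; e']%SET)); last first.
    by move=> f; rewrite E !finset.in_set.
  rewrite big_setU1 ?inE //= big_set1 => zz.
  by rewrite -[RHS]add0r -(F2_addrr (z e)) -addrA zz addr0.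
pose B := [set e in rim F | z e == 1]%SET.
have sB : B \subset rim F by apply/fintype.subsetP => e; rewrite finset.in_set => /andP[].
have [B0|B0] := eqVneq B finset.set0.
  left=> e er; have [//|ze] := F2_cases (z e).
  have : e \in B by rewrite finset.in_set er ze eqxx.
  by rewrite B0 inE.
right=> e; rewrite -(rim_connected sB B0).
  by rewrite finset.in_set => /andP[_ /eqP].
move=> f f' v; rewrite finset.in_set => /andP[fr /eqP zf] fr' vf vf'.
by rewrite finset.in_set fr' -(adjacent f f' v) // zf eqxx.
Qed.

Lemma disc_counts : F != finset.set0 ->
  (#|finset.cover F| + #|F| = #|edges F| + 1)%N /\
  (3 * #|F| + #|finset.cover (rim F)| = 2 * #|edges F|)%N.
Proof.
move=> F0; split; last by rewrite -rim_regular.1 card_faces_edges.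
apply: euler_disc => //.
- move=> F' sF'; apply: (face_rim_neq0 triT).
  exact: fintype.subset_trans sF' sF.
- by move=> z; apply: (face_dual_potential triT).
- exact: rim_even_constant.
Qed.

End Boundary.

(** * Angles of the faces with prescribed lengths *)

Section Angles.
Variables (R : realType) (V : finType) (T : {set {set V}}) (l : V -> V -> R).
Hypotheses (lenl : edge_lengths T l) (strl : strict_triangle_inequality T l).
Implicit Types (t : {set V}) (x y z i j k : V).

(** The share of one face in [angle_sum], with the same enumeration of pairs; it is 0 when [i] is
    not a vertex of [t]. *)
Definition angle_at t i : R := \sum_j \sum_(k | (enum_rank j < enum_rank k)%N &&
  ([set j; i; k]%SET == t)) angle l j i k.

Lemma set3_inj i j k x y z : #|[set x; y; z]%SET| = 3%N ->
  [set j; i; k]%SET = [set x; y; z]%SET -> i = x ->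
  (j = y /\ k = z) \/ (j = z /\ k = y).
Proof.
move=> c3 E ix; subst i.
have c3' : #|[set j; x; k]%SET| = 3%N by rewrite E.
have card2 (a b : V) : (#|[set a; b]%SET| < 3)%N by rewrite cards2; case: eqP.
have jx : j != x.
  by apply/eqP => jx; move: c3' (card2 x k); rewrite jx finset.setUid => ->.
have kx : k != x.
  apply/eqP => kx; move: c3' (card2 j x).
  by rewrite kx -finset.setUA finset.setUid => ->.
have jk : j != k.
  apply/eqP => jk; move: c3' (card2 k x).
  by rewrite jk finset.setUAC finset.setUid => ->.
have : j \in [set x; y; z]%SET by rewrite -E !inE eqxx.
have : k \in [set x; y; z]%SET by rewrite -E !inE eqxx !orbT.
rewrite !inE (negPf jx) (negPf kx) /= => /orP[] /eqP kE /orP[] /eqP jE; subst j k.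
- by rewrite eqxx in jk.
- by right.
- by left.
- by rewrite eqxx in jk.
Qed.

Lemma angle_atE x y z : [set x; y; z]%SET \in T -> #|[set x; y; z]%SET| = 3%N ->
  angle_at [set x; y; z]%SET x = angle l y x z.
Proof.
wlog yz : y z / (enum_rank y < enum_rank z)%N => [sym|] tT c3.
  have [lt|gt|/val_inj/enum_rank_inj eq] := ltngtP (enum_rank y) (enum_rank z).
  - exact: sym.
  - rewrite finset.setUAC sym //; try by rewrite finset.setUAC.
    have yz : edge T y z.
      split; first by apply/eqP => E; rewrite E ltnn in gt.
      by exists [set x; y; z]%SET => //; rewrite !inE !eqxx !orbT.
    by rewrite /angle -(lenl yz).1 [2 * l x y * _]mulrAC [l x y ^+ 2 + _]addrC.
  - by move: c3; rewrite eq -finset.setUA finset.setUid cards2; case: eqP.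
rewrite /angle_at (bigD1 y) //= (big_pred1 z) => [|k].
  rewrite big1 ?addr0 // => j jy; apply: big1 => k /andP[jk /eqP E].
  have [[jE kE]|[jE kE]] := set3_inj c3 E erefl.
    by rewrite jE eqxx in jy.
  by move: jk; rewrite jE kE ltnNge ltnW.
apply/andP/eqP => [[yk /eqP E]|->]; last by rewrite yz [[set y; x]%SET]finset.setUC.
have [[]|[_ ky]] := set3_inj c3 E erefl; first by [].
by move: yk; rewrite ky ltnn.
Qed.

Lemma face_angle_sum t : t \in T -> #|t| = 3%N -> \sum_i angle_at t i = pi.
Proof.
move=> tT t3; have [x [y [z [xy xz yz E]]]] := cards3P t3.
have Ez : t = [set z; x; y]%SET by rewrite E finset.setUC finset.setUA.
have Ey : t = [set y; z; x]%SET by rewrite Ez finset.setUC finset.setUA.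
have ed a b c : t = [set a; b; c]%SET -> a != b -> l a b = l b a /\ 0 < l a b.
  by move=> Et ab; apply: lenl; split=> //; exists t; rewrite // Et !inE !eqxx !orbT.
have [lxy lxy0] := ed _ _ _ E xy; have [lyz lyz0] := ed _ _ _ Ey yz.
have [lzx lzx0] := ed _ _ _ Ez (negbT (etrans (eq_sym z x) (negbTE xz))).
rewrite (bigID (mem t)) /= [X in _ + X]big1 ?addr0; last first.
  move=> i it; rewrite /angle_at big1 // => j _; apply: big1 => k /andP[_ /eqP jik].
  by move: it; rewrite -jik !inE eqxx orbT.
have sum3 (f : V -> R) : \sum_(i in t) f i = f x + (f y + f z).
  by rewrite E -finset.setUA !big_setU1 ?inE ?negb_or ?xy ?xz //= big_set1.
rewrite sum3.
rewrite [in angle_at t x]E [in angle_at t y]Ey [in angle_at t z]Ez.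
rewrite !angle_atE -?E -?Ey -?Ez //.
have h1 := strl (i := x) (j := y) (k := z); have h2 := strl (i := y) (j := z) (k := x).
have h3 := strl (i := z) (j := x) (k := y).
rewrite -E in h1; rewrite -Ey in h2; rewrite -Ez in h3.
have {}h1 : l z x < l x y + l y z by rewrite lzx h1.
have {}h2 : l x y < l y z + l z x by rewrite lxy h2.
have {}h3 : l y z < l z x + l x y by rewrite lyz h3.
(* The order x, z, y of the vertices matches the cyclic form of [triangle_angle_sum] for the sides
   [l x y], [l z x], [l y z]. *)
rewrite [angle l z y x + _]addrC addrA /angle -lxy -lyz -lzx.
by apply: triangle_angle_sum => //; rewrite addrC.
Qed.

Lemma angle_sum_faces (F : {set {set V}}) i :
  angle_sum l F i = \sum_(t in F) angle_at t i.
Proof.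
rewrite /angle_at exchange_big /=; apply: eq_bigr => j _.
rewrite (exchange_big_dep (fun k => (enum_rank j < enum_rank k)%N)) /=; last first.
  by move=> t k _ /andP[].
rewrite big_mkcondr /=; apply: eq_bigr => k jk; case: ifP => [jikF|jikF].
  rewrite (big_pred1 [set j; i; k]%SET) // => t /=.
  by rewrite jk /= eq_sym; case: eqP => [->|]; rewrite ?andbF ?jikF.
rewrite big_pred0 // => t; rewrite jk /= eq_sym.
by case: eqP => [->|]; rewrite ?andbF ?jikF.
Qed.

Lemma total_angle_sum (F : {set {set V}}) : F \subset T ->
  (forall t, t \in F -> #|t| = 3%N) -> \sum_i angle_sum l F i = #|F|%:R * pi.
Proof.
move=> /fintype.subsetP sF card_F; under eq_bigr do rewrite angle_sum_faces.
rewrite exchange_big /= mulr_natl -sumr_const; apply: eq_bigr => t tF.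
exact: face_angle_sum (sF _ tF) (card_F _ tF).
Qed.

End Angles.

(** * The faces of a union of stars *)

Section Faces.
Variables (R : realType) (V : finType) (pos : V -> 'rV[R]_2) (T : {set {set V}}).
Hypothesis triT : triangulation pos T.
Implicit Types (P : set 'rV[R]_2) (F : {set {set V}}).

Lemma faces_sub P : faces pos T P \subset T.
Proof. by apply/fintype.subsetP => t; rewrite finset.in_set => /andP[]. Qed.

Lemma carrier_faces P : union_of_interior_stars pos T P ->
  carrier pos (faces pos T P) = P.
Proof.
move=> [S _ PE]; apply/seteqP; split=> x.
  by move=> [t /=]; rewrite finset.in_set => /andP[_ /asboolP tP] /tP.
move=> Px; have := Px; rewrite {1}PE => -[v vS [t /= /andP[tT vt] tx]].
exists t => //=; rewrite finset.in_set tT; apply/asboolP => y ty.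
by rewrite PE; exists v => //; exists t => //=; rewrite tT.
Qed.

(** The open triangle [t] has points arbitrarily near its vertex; one of them lies in the carrier of
    [F], and an open triangle meets no other triangle. *)
Lemma interior_vertex_faces F v t : F \subset T -> nbhs (pos v) (carrier pos F) ->
  t \in T -> v \in t -> t \in F.
Proof.
move=> sF vF tT vt; have t0 : t != finset.set0.
  by rewrite -card_gt0 (triangulation_card triT).
have tm := barycenter_open_hull pos t0; set m := barycenter pos t in tm.
have [k k0 kP] := nbhs_line (m - pos v) vF.
pose d := Num.min (k / 2) 1.
have d0 : 0 < d by rewrite lt_min; apply/andP; split; lra.
have d1 : d <= 1 by rewrite ge_min lexx orbT.
have dk : d < k by rewrite gt_min; apply/orP; left; lra.
apply: (carrier_open_hull triT sF tT (x := pos v + d *: (m - pos v))); last first.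
  by apply: kP; rewrite gtr0_norm.
have -> : pos v + d *: (m - pos v) = m + (1 - d) *: (pos v - m).
  by apply/rowP => n; rewrite !mxE; ring.
by apply: open_hull_convex => //; [exact: hull_vertex|lra].
Qed.

End Faces.

(** * The turning angle of the boundary curve *)

Theorem theorem8 (R : realType) (V : finType) (pos : V -> 'rV[R]_2)
    (T : {set {set V}}) (l : V -> V -> R) (P gamma : set 'rV[R]_2)
    (triT : triangulation pos T)
    (lenl : edge_lengths T l)
    (strl : strict_triangle_inequality T l)
    (compl : compatible pos T l)
    (starsP : union_of_interior_stars pos T P)
    (curve : simple_closed_curve gamma)
    (bdP : bounded_by P gamma) :
  2 * pi = \sum_(i | pos i \in gamma) (pi - angle_sum l (faces pos T P) i) :> R.
Proof.
have PE := carrier_faces starsP; set F := faces pos T P in PE *.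
have sF : F \subset T := faces_sub pos T P.
have gE : carrier pos (rim F) = gamma by rewrite -(carrier_frontier triT sF) PE.
have card_F t : t \in F -> #|t| = 3%N.
  by move=> /(fintype.subsetP sF); exact: triangulation_card triT t.
rewrite -gE in curve *.
have F0 : F != finset.set0.
  have [c [_ _ _ cE]] := curve.
  have [e er _] : carrier pos (rim F) (c 0) by rewrite cE; exists 0; rewrite //= in_itv /=; lra.
  have /edgesP[_ [t tF _]] := fintype.subsetP (rim_edges F) _ er.
  by apply/set0Pn; exists t.
have [euler edge_count] := disc_counts triT sF curve F0.
set W := finset.cover (rim F) in edge_count.
have inW i : (pos i \in carrier pos (rim F)) = (i \in W).
  apply/idP/idP => [/set_mem[e er ei]|/bigcupP[e er ie]]; last first.
    by apply/mem_set; exists e => //; exact: hull_vertex.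
  have /edgesP[_ [t tF et]] := fintype.subsetP (rim_edges F) _ er.
  apply/bigcupP; exists e => //.
  exact: (vertex_in_face triT (fintype.subsetP sF _ tF) et ei).
have sW : W \subset finset.cover F.
  apply/fintype.subsetP => i /bigcupP[e er ie].
  have /edgesP[_ [t tF /fintype.subsetP et]] := fintype.subsetP (rim_edges F) _ er.
  by apply/bigcupP; exists t; rewrite ?et.
(* A vertex of [P] off [gamma] is interior to [P], so all faces of [T] around it belong to [F] and
   compatibility gives its angle sum. *)
have inner i : i \in (finset.cover F :\: W)%SET -> angle_sum l F i = 2 * pi.
  rewrite finset.in_setD => /andP[iW /bigcupP[t tF it]].
  have iF : nbhs (pos i) (carrier pos F).
    apply: (carrier_interior triT sF); first by exists t => //; exact: hull_vertex.
    by move=> e er ei; move/negP: iW; apply; rewrite -inW; apply/mem_set; exists e.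
  rewrite -(compl i); last exact: filterS (carrier_subset sF) iF.
  apply: eq_bigr => j _; apply: eq_bigl => k; congr (_ && _).
  apply/idP/idP => [/(fintype.subsetP sF)//|jikT].
  by apply: (interior_vertex_faces triT sF iF jikT); rewrite !inE eqxx orbT.
have outer i : i \notin finset.cover F -> angle_sum l F i = 0.
  move=> iF; rewrite angle_sum_faces big1 // => t tF.
  rewrite /angle_at big1 // => j _; apply: big1 => k /andP[_ /eqP jik].
  move/negP: iF => []; apply/bigcupP; exists t => //.
  by rewrite -jik !inE eqxx orbT.
(* Removing the 2 pi of each inner vertex from the total leaves the angles along [gamma]. *)
have := total_angle_sum lenl strl sF card_F.
rewrite (bigID (mem (finset.cover F))) /= [X in _ + X]big1 ?addr0 //.
rewrite (big_setID W) /= (finset.setIidPr sW) (eq_bigr _ inner) sumr_const.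
rewrite cardsD (finset.setIidPr sW) => total.
rewrite (eq_bigl (fun i => i \in W)) // sumrB sumr_const.
have -> : \sum_(i in W) angle_sum l F i =
    #|F|%:R * pi - (2 * pi) *+ (#|finset.cover F| - #|W|) by rewrite -total addrK.
rewrite -[pi *+ _]mulr_natr -[(2 * pi) *+ _]mulr_natr natrB ?subset_leq_card //.
have {}euler : #|finset.cover F|%:R = #|edges F|%:R + 1 - #|F|%:R :> R.
  by apply/eqP; rewrite eq_sym subr_eq -natrD euler natrD.
have {}edge_count : #|W|%:R = 2 * #|edges F|%:R - 3 * #|F|%:R :> R.
  by apply/eqP; rewrite eq_sym subr_eq -!natrM -natrD -edge_count addnC.
by rewrite euler edge_count; ring.
Qed.
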